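(* For every $n\ge 1$, the map $\rho:S_n\to \mathrm{dRec}_n$ restricts to a bijection between the twisted Baxter permutations in $S_n$ and the diagonal rectangulations of size $n$.
   Context: Permutations are written in one-line notation $x=x_1x_2\cdots x_n\in S_n$. $x$ contains the pattern 3-41-2 if $x_1\cdots x_n$ has a subsequence $c\,d\,a\,b$ with $a<b<c<d$ in which $d$ occurs immediately before $a$ in $x$; $x$ contains 2-41-3 if it has a subsequence $b\,d\,a\,c$ with $a<b<c<d$ in which $d$ occurs immediately before $a$ in $x$. Otherwise $x$ avoids the pattern. A twisted Baxter permutation is a permutation avoiding both 3-41-2 and 2-41-3. Diagonal rectangulations. Let $S$ be a square with sides parallel to the coordinate axes; its diagonal is the interior of the segment from its top-left corner to its bottom-right corner. For a subdivision of $S$ into finitely many (axis-parallel) rectangles, the walls are the maximal line segments contained in the union of the boundaries of the rectangles, excluding the four edges of $S$. For a set $X$ of $n-1$ distinct points on the diagonal, a diagonal rectangulation of $(S,X)$ is a subdivision of $S$ into rectangles such that no two walls intersect in their interiors, every wall contains a point of $X$, and every point of $X$ lies on exactly one wall. Diagonal rectangulations are considered up to dilation or translation of $S$ and order-preserving motion of the points of $X$ along the diagonal (carrying the walls along); an equivalence class is a diagonal rectangulation of size $n$, and it has a unique integral representative, with $S=[0,n]\times[0,n]$ and $X=\{(i,n-i):1\le i\le n-1\}$. $\mathrm{dRec}_n$ is the set of diagonal rectangulations of size $n$, identified with their integral representatives. The map $\rho:S_n\to\mathrm{dRec}_n$. Let $S=[0,n]\times[0,n]$, $p_i=(i,n-i)$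 for $0\le i\le n$, and give the space between $p_{k-1}$ and $p_k$ the label $k$. Read $x_1\cdots x_n$ from left to right, drawing one rectangle for each entry. Let $T_{i-1}$ be the union of the left and bottom edges of $S$ and the rectangles drawn in the first $i-1$ steps. In step $i$, put $k=x_i$, $p=p_{k-1}$, $p'=p_k$, and draw the rectangle with the following top-left and bottom-right corners. If $p\notin T_{i-1}$, the top-left corner is the rightmost point of $T_{i-1}$ directly left of $p$; if $p\in T_{i-1}$, it is the highest point of $T_{i-1}$ directly above (or equal to) $p$. If $p'\notin T_{i-1}$, the bottom-right corner is the highest point of $T_{i-1}$ directly below $p'$; if $p'\in T_{i-1}$, it is the rightmost point of $T_{i-1}$ directly right of (or equal to) $p'$. The $n$ rectangles drawn form the diagonal rectangulation $\rho(x)$. *)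

(* Defs.v *)
From HB Require Import structures.
From mathcomp Require Import all_boot all_order all_fingroup all_algebra.
From mathcomp Require Import boolp classical_sets functions cardinality reals.

Set Implicit Arguments.
Unset Strict Implicit.
Unset Printing Implicit Defensive.

Import Order.TTheory GRing.Theory Num.Theory.

Local Open Scope classical_set_scope.
Local Open Scope ring_scope.

Section Permutations.
Variables (n : nat) (x : 'S_n).

(* The positions i, j, k, l carry the entries c, d, a, b; the vinculum "41"
   says that positions j and k are adjacent. *)
Definition contains_3_41_2 : Prop :=
  exists i j k l : 'I_n,
    [/\ (i < j)%N, k = j.+1 :> nat, (k < l)%N &
        [/\ (x k < x l)%N, (x l < x i)%N & (x i < x j)%N]].

(* The positions i, j, k, l carry the entries b, d, a, c. *)
Definition contains_2_41_3 : Prop :=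
  exists i j k l : 'I_n,
    [/\ (i < j)%N, k = j.+1 :> nat, (k < l)%N &
        [/\ (x k < x i)%N, (x i < x l)%N & (x l < x j)%N]].

Definition twisted_baxter : Prop := ~ contains_3_41_2 /\ ~ contains_2_41_3.

(* x_1 ... x_n with entries in {1, ..., n}, whereas 'I_n = {0, ..., n-1}. *)
Definition one_line : seq nat := [seq (x i).+1 | i <- enum 'I_n].

End Permutations.

Section Plane.
Variable R : realType.

Definition point : Type := (R * R)%type.

Definition between (a b : point) (t : R) : point :=
  ((1 - t) * a.1 + t * b.1, (1 - t) * a.2 + t * b.2).

Definition seg (a b : point) : set point :=
  [set q | exists t : R, 0 <= t <= 1 /\ q = between a b t].

Definition oseg (a b : point) : set point :=
  [set q | exists t : R, 0 < t < 1 /\ q = between a b t].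

Definition is_segment (L : set point) : Prop :=
  exists a b : point, a <> b /\ L = seg a b.

Definition seg_interior (L : set point) : set point :=
  [set q | exists a b : point, [/\ a <> b, L = seg a b & oseg a b q]].

(* An axis-parallel rectangle, given by its top-left and bottom-right
   corners; [proper] says that it is not degenerate. *)
Record rectangle : Type := Rectangle { tl : point; br : point }.

Definition bl (r : rectangle) : point := ((tl r).1, (br r).2).
Definition tr (r : rectangle) : point := ((br r).1, (tl r).2).

Definition proper (r : rectangle) : Prop :=
  (tl r).1 < (br r).1 /\ (br r).2 < (tl r).2.

Definition is_square (r : rectangle) : Prop :=
  proper r /\ (br r).1 - (tl r).1 = (tl r).2 - (br r).2.

Definition region (r : rectangle) : set point :=
  [set q | (tl r).1 <= q.1 <= (br r).1 /\ (br r).2 <= q.2 <= (tl r).2].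

Definition rect_interior (r : rectangle) : set point :=
  [set q | (tl r).1 < q.1 < (br r).1 /\ (br r).2 < q.2 < (tl r).2].

Definition boundary (r : rectangle) : set point := region r `\` rect_interior r.

Definition left_edge (r : rectangle) : set point := seg (tl r) (bl r).
Definition bottom_edge (r : rectangle) : set point := seg (bl r) (br r).
Definition right_edge (r : rectangle) : set point := seg (tr r) (br r).
Definition top_edge (r : rectangle) : set point := seg (tl r) (tr r).

Definition is_edge (r : rectangle) (L : set point) : Prop :=
  [\/ L = left_edge r, L = bottom_edge r, L = right_edge r | L = top_edge r].

Definition diagonal (S : rectangle) : set point := oseg (tl S) (br S).

Definition subdivision (S : rectangle) (D : set rectangle) : Prop :=
  [/\ finite_set D,
      forall r, D r -> proper r,
      \bigcup_(r in D) region r = region S &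
      forall r r', D r -> D r' -> r <> r' ->
        rect_interior r `&` rect_interior r' = set0].

Definition boundaries (D : set rectangle) : set point :=
  \bigcup_(r in D) boundary r.

Definition wall (S : rectangle) (D : set rectangle) (L : set point) : Prop :=
  [/\ is_segment L,
      L `<=` boundaries D,
      forall L', is_segment L' -> L' `<=` boundaries D -> L `<=` L' -> L' = L &
      ~ is_edge S L].

Record diagonal_rectangulation (S : rectangle) (X : set point)
    (D : set rectangle) : Prop := DiagonalRectangulation {
  dr_square : is_square S;
  dr_finite_points : finite_set X;
  dr_points_diagonal : X `<=` diagonal S;
  dr_subdivision : subdivision S D;
  dr_walls_noncrossing : forall L L', wall S D L -> wall S D L' -> L <> L' ->
    seg_interior L `&` seg_interior L' = set0;
  dr_wall_point : forall L, wall S D L -> exists2 p, X p & L p;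
  dr_point_wall : forall p, X p -> exists! L, wall S D L /\ L p
}.

Variable n : nat.

Definition int_square : rectangle := Rectangle (0, n%:R) (n%:R, 0).

Definition dpoint (i : nat) : point := (i%:R, n%:R - i%:R).

Definition int_points : set point :=
  [set q | exists i : nat, (0 < i < n)%N /\ q = dpoint i].

(* A diagonal rectangulation of size n is identified with the unique integral
   representative of its class under dilation and translation of the square
   and order-preserving motion of the points along the diagonal. *)
Definition dRec : set (set rectangle) :=
  [set D | diagonal_rectangulation int_square int_points D].

Section Step.
Variable T : set point.

Definition rightmost (A : set point) (q : point) : Prop :=
  A q /\ forall q', A q' -> q'.1 <= q.1.

Definition highest (A : set point) (q : point) : Prop :=
  A q /\ forall q', A q' -> q'.2 <= q.2.

(* [xget p A] is a chosen element of A (here A has at most one), with the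
   dummy value p when A is empty. *)
Definition rightmost_left (p : point) : point :=
  xget p (rightmost [set q | [/\ T q, q.2 = p.2 & q.1 < p.1]]).

Definition highest_above (p : point) : point :=
  xget p (highest [set q | [/\ T q, q.1 = p.1 & p.2 <= q.2]]).

Definition highest_below (p : point) : point :=
  xget p (highest [set q | [/\ T q, q.1 = p.1 & q.2 < p.2]]).

Definition rightmost_right (p : point) : point :=
  xget p (rightmost [set q | [/\ T q, q.2 = p.2 & p.1 <= q.1]]).

Definition draw (k : nat) : rectangle :=
  let p := dpoint k.-1 in
  let p' := dpoint k in
  Rectangle (if `[< T p >] then highest_above p else rightmost_left p)
            (if `[< T p' >] then rightmost_right p' else highest_below p').

End Step.

Definition drawn (D : set rectangle) : set point :=
  left_edge int_square `|` bottom_edge int_square `|`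
  \bigcup_(r in D) region r.

Definition rho (x : 'S_n) : set rectangle :=
  foldl (fun D k => D `|` [set draw (drawn D) k]) set0 (one_line x).

End Plane.

Arguments dRec : clear implicits.
Arguments rho R {n} x : rename.

(* Main.v *)
(* The k-th rectangle drawn by rho depends on x only through the set A of labels
   preceding k in x: with depths measured from the top edge of S, its left and
   top sides lie at the largest j < k in A, resp. not in A (or 0), and its right
   and bottom sides lie just before the smallest j > k not in A, resp. in A
   (or n + 1).  The unit cell in column i and row j belongs to the rectangle of
   the first (if i <= j) or last (if i >= j) label of x between i and j, so these
   rectangles tile S, with exactly one wall through each diagonal point.

   Conversely, in a diagonal rectangulation no corner can be on the wrong side of
   the diagonal, since the walls meeting there would cross on their way to it.
   Hence every rectangle contains exactly one of the diagonal unit segments, and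
   the rectangles can be peeled off one by one from the bottom left, in an order
   which is a preimage under rho.

   Exchanging an adjacent descent d a of x preserves rho(x) exactly when some
   value between a and d occurs before it and another one after it, that is, when
   d a is part of one of the two patterns; hence a permutation of a fibre that is
   extremal for such exchanges is twisted Baxter.  It is unique, because every
   inversion of a twisted Baxter permutation is forced by the sides of the
   rectangles, hence is an inversion of all the permutations of the fibre. *)

Require Import Defs.
From mathcomp Require Import all_boot all_order all_fingroup all_algebra.
From mathcomp Require Import boolp classical_sets functions cardinality reals.
From mathcomp Require Import zify lra ring.
Import Defs.

Set Implicit Arguments.
Unset Strict Implicit.
Unset Printing Implicit Defensive.

Local Open Scope classical_set_scope.

(** * Boxes of a permutation *)

Section Box.
Variable n : nat.

Fixpoint pred_below (P : pred nat) (k : nat) : nat :=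
  if k is j.+1 then if P j then j else pred_below P j else 0.

(** [find] counts the labels skipped after [k], so the value is one less than the first label
    satisfying [P], or [n] when there is none. *)
Definition next_above (P : pred nat) (k : nat) : nat :=
  k + find P (iota k.+1 (n - k)).

(* [l b] is the largest j < k with [A j = b], or 0; [(h b).+1] is the smallest
   j > k with [A j = ~~ b], or n.+1.  When A is the set of labels drawn before
   k, these are the sides of the k-th rectangle: l true and h true are its left
   and right abscissas, l false and h false the depths, measured from the top
   edge of S, of its top and bottom edges. *)
Definition is_box (A : pred nat) (k : nat) (l h : bool -> nat) : Prop :=
  forall b,
  [/\ l b < k, l b = 0 \/ A (l b) = b & forall j, l b < j < k -> A j = ~~ b] /\
  [/\ k <= h b <= n, h b = n \/ A (h b).+1 = ~~ b &
      forall j, k < j <= h b -> A j = b].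

Definition box_lo (A : pred nat) (k : nat) (b : bool) : nat :=
  pred_below (fun j => A j == b) k.
Definition box_hi (A : pred nat) (k : nat) (b : bool) : nat :=
  next_above (fun j => A j == ~~ b) k.

Lemma pred_belowP (P : pred nat) k : 0 < k ->
  [/\ pred_below P k < k, pred_below P k = 0 \/ P (pred_below P k) &
      forall j, pred_below P k < j < k -> ~~ P j].
Proof.
elim: k => // k IH _ /=.
case: ifP => Pk; first by split=> //; [right | move=> j; lia].
have [->|k0] := posnP k; first by split=> //=; [left | move=> j; lia].
have [h1 h2 h3] := IH k0; split=> //; first lia.
move=> j hj; have [->|jk] := eqVneq j k; first by rewrite Pk.
apply: h3; lia.
Qed.

Lemma next_aboveP (P : pred nat) k : k <= n ->
  [/\ k <= next_above P k <= n, next_above P k = n \/ P (next_above P k).+1 &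
      forall j, k < j <= next_above P k -> ~~ P j].
Proof.
rewrite /next_above => kn; set s := iota _ _.
have sz : size s = n - k by rewrite size_iota.
have fle := find_size P s.
split; first lia.
  case: (boolP (has P s)) => hs; last by left; move: hs => /hasNfind ->; lia.
  right; have := nth_find 0 hs; rewrite nth_iota ?addSn //.
  by rewrite -sz -has_find.
move=> j hj; have := @before_find _ 0 P s (j - k.+1).
rewrite nth_iota; last lia.
have -> : k.+1 + (j - k.+1) = j by lia.
by move=> -> //; lia.
Qed.

Lemma is_box_ex A k : 1 <= k <= n -> is_box A k (box_lo A k) (box_hi A k).
Proof.
move=> /andP[k1 kn] b; split.
  have [h1 h2 h3] := pred_belowP (fun j => A j == b) k1; split=> //.
    by case: h2 => [|/eqP]; [left|right].
  by move=> j /h3; case: (A j) b {h1 h2 h3} => [] [].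
have [h1 h2 h3] := next_aboveP (fun j => A j == ~~ b) kn; split=> //.
  by case: h2 => [|/eqP]; [left|right].
by move=> j /h3; case: (A j) b {h1 h2 h3} => [] [].
Qed.

Lemma is_box_ext (A A' : pred nat) k l h : (forall j, 1 <= j <= n -> j != k -> A j = A' j) ->
  is_box A k l h -> is_box A' k l h.
Proof.
move=> E H b; have [[a1 a2 a3] [b1 b2 b3]] := H b.
split; split=> //.
- case: (posnP (l b)) => [|lp]; [by left|right].
  by case: a2 => [|a2]; [lia | rewrite -E ?a2 //; lia].
- by move=> j hj; rewrite -E ?a3 //; lia.
- have [e|ne] := eqVneq (h b) n; [by left|right].
  by case: b2 => [|b2]; [lia | rewrite -E ?b2 //; lia].
- by move=> j hj; rewrite -E ?b3 //; lia.
Qed.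

(* Flipping the membership of z does not change the box of k as soon as both a
   member and a nonmember lie strictly between z and k. *)
Lemma is_box_flip (A A' : pred nat) k l h z v w :
  (forall j, j != z -> A j = A' j) ->
  (z < v < k) && (z < w < k) || (k < v < z) && (k < w < z) ->
  A v -> ~~ A w ->
  is_box A k l h -> is_box A' k l h.
Proof.
move=> E zvw Av Aw H b; have [[a1 a2 a3] [b1 b2 b3]] := H b.
pose u := if b then v else w.
have Au : A u = b by rewrite /u; case: (b) => //; apply: negbTE.
case/orP: zvw => zvw.
  have zu : z < u < k by rewrite /u; case: (b); lia.
  have lu : u <= l b.
    rewrite leqNgt; apply/negP => lt.
    have := a3 u; rewrite Au lt => /(_ ltac:(lia)).
    by case: (b).
  split; split=> //.
  - by case: a2 => [|a2]; [left|right; rewrite -E ?a2 //; lia].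
  - by move=> j hj; rewrite -E ?a3 //; lia.
  - by case: b2 => [|b2]; [left|right; rewrite -E ?b2 //; lia].
  - by move=> j hj; rewrite -E ?b3 //; lia.
pose t := if b then w else v.
have At : A t = ~~ b by rewrite /t; case: (b) => //; apply: negbTE.
have zt : k < t < z by rewrite /t; case: (b); lia.
have ht : h b < t.
  rewrite ltnNge; apply/negP => lt.
  have := b3 t; rewrite At lt => /(_ ltac:(lia)).
  by case: (b).
split; split=> //.
- by case: a2 => [|a2]; [left|right; rewrite -E ?a2 //; lia].
- by move=> j hj; rewrite -E ?a3 //; lia.
- by case: b2 => [|b2]; [left|right; rewrite -E ?b2 //; lia].
- by move=> j hj; rewrite -E ?b3 //; lia.
Qed.

(** * Bounds on the sides of a single box *)

Section Sides.
Variables (A : pred nat) (k : nat) (l h : bool -> nat).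
Hypothesis H : is_box A k l h.

Lemma lo_lt b : l b < k. Proof. by have [[]] := H b. Qed.
Lemma lo_mem b : 0 < l b -> A (l b) = b.
Proof. by have [[_ [->|]]] := H b. Qed.
Lemma lo_gap b j : l b < j < k -> A j = ~~ b.
Proof. by have [[_ _ E] _] := H b; apply: E. Qed.
Lemma hi_ge b : k <= h b. Proof. by have [_ [/andP[]]] := H b. Qed.
Lemma hi_le b : h b <= n. Proof. by have [_ [/andP[]]] := H b. Qed.
Lemma hi_mem b : h b < n -> A (h b).+1 = ~~ b.
Proof. by have [_ [_ [->|]]] := H b; rewrite ?ltnn. Qed.
Lemma hi_gap b j : k < j <= h b -> A j = b.
Proof. by have [_ [_ _ E]] := H b; apply: E. Qed.

Lemma lo_le b j : j < k -> (0 < j -> A j = b) -> j <= l b.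
Proof.
move=> jk Aj; rewrite leqNgt; apply/negP => lt.
by have := @lo_gap b j ltac:(lia); rewrite Aj; [case: (b) | lia].
Qed.

Lemma lo_lt_of b j : j < k -> A j = ~~ b -> 0 < j -> (forall i, j < i < k -> A i = ~~ b) -> l b < j.
Proof.
move=> jk Aj j0 Ai; rewrite ltnNge; apply/negP => le.
have [e|ne] := eqVneq (l b) j.
  by have := lo_mem (b := b); rewrite e Aj => /(_ j0); case: (b).
have := lo_mem (b := b); rewrite Ai; last by have := lo_lt b; lia.
by move=> /(_ ltac:(lia)); case: (b).
Qed.

Lemma hi_ge_of b j : j <= n -> (forall i, k < i <= j -> A i = b) -> j <= h b.
Proof.
move=> jn Ai; rewrite leqNgt; apply/negP => lt.
have := hi_mem (b := b); rewrite Ai; last by have := hi_ge b; lia.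
by move=> /(_ ltac:(lia)); case: (b).
Qed.

Lemma hi_lt_of b j : k < j -> A j = ~~ b -> h b < j.
Proof.
move=> kj Aj; rewrite ltnNge; apply/negP => le.
by have := @hi_gap b j ltac:(lia); rewrite Aj; case: (b).
Qed.

(** Drawn or not, the label [k - 1] stops one of the two downward searches at once. *)
Lemma lo_pred : 1 < k -> l (A k.-1) = k.-1.
Proof.
move=> k1; have := lo_lt (A k.-1); have := @lo_le (A k.-1) k.-1.
by move=> /(_ ltac:(lia) (fun=> erefl)); lia.
Qed.

Lemma hi_succ : k < n -> h (~~ A k.+1) = k.
Proof.
move=> kn; have := @hi_lt_of (~~ A k.+1) k.+1; have := hi_ge (~~ A k.+1).
by rewrite negbK => + /(_ (ltnSn _) erefl); lia.
Qed.
End Sides.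
End Box.

(* [p j] is the position of the label j in the permutation. *)
Definition is_boxes (n : nat) (p : nat -> nat) (l h : nat -> bool -> nat) : Prop :=
  forall k, 1 <= k <= n -> is_box n (fun j => p j < p k) k (l k) (h k).

(** * Walls and cells of the boxes of a permutation *)

Section Positions.
Variables (n : nat) (p : nat -> nat).
Hypothesis pinj : forall i j, 1 <= i <= n -> 1 <= j <= n -> p i = p j -> i = j.
Variables (l h : nat -> bool -> nat).
Hypothesis H : is_boxes n p l h.

Lemma pos_neq i j : 1 <= i <= n -> 1 <= j <= n -> i != j -> p i != p j.
Proof. by move=> ii jj; apply: contra_neq; apply: pinj. Qed.

(** Together with [hi_diag] this says that the box of [k] meets the diagonal only in the [k]-th unit
    segment. *)
Lemma lo_diag k : 1 <= k <= n -> l k true = k.-1 \/ l k false = k.-1.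
Proof.
move=> kk; case: (ltnP 1 k) => k1.
  have := lo_pred (H kk) k1; case: (p k.-1 < p k); by [left|right].
left; have := lo_lt (H kk) true; lia.
Qed.

Lemma hi_diag k : 1 <= k <= n -> h k true = k \/ h k false = k.
Proof.
move=> kk; case: (ltnP k n) => k1.
  have := hi_succ (H kk) k1; case: (p k.+1 < p k); by [left|right].
left; have := hi_ge (H kk) true; have := hi_le (H kk) true; lia.
Qed.

Lemma wall_at i : 0 < i < n ->
  let b := p i < p i.+1 in [/\ l i.+1 b = i, h i b = i,
    l i.+1 (~~ b) < i & i < h i (~~ b)].
Proof.
move=> ii b; have Hi := H (k := i) ltac:(lia); have Hi1 := H (k := i.+1) ltac:(lia).
have nb : (p i.+1 < p i) = ~~ b.
  rewrite /b; have := @pos_neq i i.+1 ltac:(lia) ltac:(lia) ltac:(lia); lia.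
split.
- by have /= := lo_pred Hi1; apply; lia.
- by have := hi_succ Hi; rewrite nb negbK; apply; lia.
- by apply: (lo_lt_of Hi1) => //; [rewrite negbK | lia | move=> j; lia].
- apply: (hi_ge_of Hi); first lia.
  by move=> j jj; have -> : j = i.+1 by lia.
Qed.

(** For [b = true], the stopping label [i + 1] comes after [k], while [i] is [k] or comes before it.
    A label that stops the downward search from [i + 1] also comes after [k] and is not in [(k, i]],
    so it stops the search from [k] too. *)
Lemma wall_hi k b i : 1 <= k <= n -> h k b = i -> i < n ->
  [/\ b = (p i < p i.+1), l i.+1 (~~ b) <= l k (~~ b) & h k (~~ b) <= h i (~~ b)].
Proof.
move=> kk ei hn; have ki : k <= i by have := hi_ge (H kk) b; lia.
have Hi := H (k := i) ltac:(lia); have Hi1 := H (k := i.+1) ltac:(lia).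
have /= Ai1 := hi_mem (H kk) (b := b) ltac:(lia); rewrite ei in Ai1.
have ne := @pos_neq i.+1 k ltac:(lia) ltac:(lia) ltac:(lia).
have ne1 := @pos_neq i i.+1 ltac:(lia) ltac:(lia) ltac:(lia).
have gap := @hi_gap _ _ _ _ _ (H kk) b; rewrite ei /= in gap.
have Ai : i = k \/ (p i < p k) = b.
  by have [->|ne'] := eqVneq i k; [left|right; apply: gap; lia].
split.
- by move: ne1 ne Ai1; case: Ai => [->|]; case: (b); rewrite /=; lia.
- apply: (lo_le (H kk)) => [|l0].
    have [e|ne'] := eqVneq (l i.+1 (~~ b)) k.
      have /= := lo_mem Hi1 (b := ~~ b); rewrite e => /(_ ltac:(lia)) E.
      by move: ne Ai1 E; case: (b); rewrite /=; lia.
    rewrite ltnNge; apply/negP => le.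
    have lt := lo_lt Hi1 (~~ b).
    have := gap (l i.+1 (~~ b)) ltac:(lia) => G.
    have /= E := lo_mem Hi1 (b := ~~ b) ltac:(lia).
    by move: ne Ai1 E G; case: (b); rewrite /=; lia.
  have /= E := lo_mem Hi1 l0.
  by move: Ai1 E; case: (b); rewrite /=; lia.
- case: (eqVneq i k) => [->//|ne'].
  have := hi_ge Hi (~~ b).
  have := hi_diag kk; move: ei ne'; case: (b) => /= ei ne' [] h1 h2; lia.
Qed.

(** The mirror image of [wall_hi], with the roles of [i] and [i + 1] exchanged. *)
Lemma wall_lo k b i : 1 <= k <= n -> l k b = i -> 0 < i ->
  [/\ b = (p i < p i.+1), l i.+1 (~~ b) <= l k (~~ b) & h k (~~ b) <= h i (~~ b)].
Proof.
move=> kk ei i0; have ki : i < k by have := lo_lt (H kk) b; lia.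
have Hi := H (k := i) ltac:(lia); have Hi1 := H (k := i.+1) ltac:(lia).
have /= Ai := lo_mem (H kk) (b := b) ltac:(lia); rewrite ei in Ai.
have gap := @lo_gap _ _ _ _ _ (H kk) b; rewrite ei /= in gap.
have Ai1 : i.+1 = k \/ (p i.+1 < p k) = ~~ b.
  by have [->|ne'] := eqVneq i.+1 k; [left|right; apply: gap; lia].
have ne := @pos_neq i k ltac:(lia) ltac:(lia) ltac:(lia).
split.
- by move: ne Ai; case: Ai1 => [->|]; case: (b); rewrite /=; lia.
- case: (eqVneq i.+1 k) => [->//|ne'].
  have := lo_lt Hi1 (~~ b).
  by have := lo_diag kk; move: ei ne'; case: (b) => /= ei ne' [] h1 h2; lia.
- rewrite leqNgt; apply/negP => lt.
  set j := (h i (~~ b)).+1.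
  have jn : j <= n by have := hi_le (H kk) (~~ b); rewrite /j; lia.
  have ij : i < j by have := hi_ge Hi (~~ b); rewrite /j; lia.
  have /= E := hi_mem Hi (b := ~~ b) jn; rewrite negbK -/j in E.
  have [e|nej] := eqVneq j k.
    rewrite e in E; by move: Ai E; case: (b); lia.
  have [jk|kj] := ltnP j k.
    have G := gap j ltac:(lia).
    by move: Ai E G; case: (b); rewrite /=; lia.
  have /= G := hi_gap (H kk) (b := ~~ b) (j := j) ltac:(lia).
  by move: ne Ai E G; case: (b); rewrite /=; lia.
Qed.

(** For [i < j], the gap conditions of [h i (~~ b)] at [j + 1] and of [l j.+1 b] at [i] order these
    two labels in opposite ways; for [j < i] the same happens to [i + 1] and [j]. *)
Lemma walls_noncrossing i j (b := p i < p i.+1) : 0 < i < n -> 0 < j < n ->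
  (p j < p j.+1) = ~~ b ->
  l i.+1 (~~ b) < j < h i (~~ b) -> l j.+1 b < i < h j b -> False.
Proof.
move=> ii jj E hj hi.
have Hi := H (k := i) ltac:(lia); have Hi1 := H (k := i.+1) ltac:(lia).
have Hj := H (k := j) ltac:(lia); have Hj1 := H (k := j.+1) ltac:(lia).
have ne1 := @pos_neq i i.+1 ltac:(lia) ltac:(lia) ltac:(lia).
have ne2 := @pos_neq j j.+1 ltac:(lia) ltac:(lia) ltac:(lia).
have [e|ne] := eqVneq i j; first by rewrite -e in E; move: E; rewrite /b; lia.
have [ij|ji] := ltnP i j.
  have /= G := hi_gap Hi (b := ~~ b) (j := j.+1) ltac:(lia).
  have /= G' := lo_gap Hj1 (b := b) (j := i) ltac:(lia).
  have := @pos_neq i j.+1 ltac:(lia) ltac:(lia) ltac:(lia).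
  by move: E G G'; rewrite /b; lia.
have /= G := lo_gap Hi1 (b := ~~ b) (j := j) ltac:(lia).
have /= G' := hi_gap Hj (b := b) (j := i.+1) ltac:(lia).
have := @pos_neq i.+1 j ltac:(lia) ltac:(lia) ltac:(lia).
by move: E G G'; rewrite negbK /b; lia.
Qed.

Lemma ex_first (r : bool) i j : i <= j ->
  exists2 k, i <= k <= j & forall m, i <= m <= j -> if r then p k <= p m else p m <= p k.
Proof.
move=> ij; have -> : j = i + (j - i) by lia.
elim: (j - i) => [|d [k kk IH]].
  exists i; [lia|move=> m mm].
  by (have -> : m = i by lia); case: r.
have [lt|ge] := boolP (if r then p k <= p (i + d.+1) else p (i + d.+1) <= p k).
  exists k; [lia|move=> m mm].
  have [->//|ne] := eqVneq m (i + d.+1); apply: IH; lia.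
exists (i + d.+1); [lia|move=> m mm].
have [->|ne] := eqVneq m (i + d.+1); first by case: r {IH ge}.
have := IH m ltac:(lia); case: r ge {IH}; lia.
Qed.

(** Among the labels between the two coordinates, take the first in position if the cell is on or
    below the diagonal, the last otherwise. All the others lie on one side of it in the permutation,
    so its box extends to the cell. *)
Lemma boxes_cover (c : bool -> nat) : (forall b, 1 <= c b <= n) ->
  exists2 k, 1 <= k <= n & forall b, l k b < c b <= h k b.
Proof.
move=> cc.
have [r le] : exists r, c r <= c (~~ r).
  by case: (leqP (c true) (c false)) => [|/ltnW] ?; [exists true|exists false].
have [k kk kmin] := ex_first r le.
have k1 : 1 <= k <= n by have := cc r; have := cc (~~ r); lia.
have kmin' m : c r <= m <= c (~~ r) -> m != k -> (p m < p k) = ~~ r.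
  move=> mm mk; have := kmin m mm; have := cc r; have := cc (~~ r) => c1 c2.
  have := @pos_neq m k ltac:(lia) k1 mk; case: (r); lia.
exists k => // b.
have [->|/negbTE ne] := eqVneq b r.
  have := hi_ge (H k1) r; suff : l k r < c r by lia.
  have [e|lt] := eqVneq (c r) k; first by have := lo_lt (H k1) r; lia.
  apply: (lo_lt_of (H k1)) => [||| j jj]; first lia.
  - apply: kmin'; lia.
  - by have := cc r; lia.
  - apply: kmin'; lia.
have {ne} -> : b = ~~ r by case: (b) ne; case: (r).
have := lo_lt (H k1) (~~ r); suff : c (~~ r) <= h k (~~ r) by lia.
apply: (hi_ge_of (H k1)) => [|j jj]; first by have := cc (~~ r); lia.
apply: kmin'; lia.
Qed.

Lemma boxes_disjoint (c : bool -> nat) k k' : 1 <= k <= n -> 1 <= k' <= n ->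
  (forall b, l k b < c b <= h k b) -> (forall b, l k' b < c b <= h k' b) -> k = k'.
Proof.
(* Any box containing the cell has the extremal label between the coordinates, and there is only one
   such label. *)
suff Hw k0 : 1 <= k0 <= n -> (forall b, l k0 b < c b <= h k0 b) ->
    forall r, c r <= c (~~ r) -> c r <= k0 <= c (~~ r) /\
    forall m, c r <= m <= c (~~ r) -> m != k0 -> (p m < p k0) = ~~ r.
  move=> kk kk' A A'; apply/eqP; apply/negP => /negP ne.
  have [r le] : exists r, c r <= c (~~ r).
    by case: (leqP (c true) (c false)) => [|/ltnW] ?; [exists true|exists false].
  have [a1 a2] := Hw _ kk A r le; have [b1 b2] := Hw _ kk' A' r le.
  have := a2 k' b1 ltac:(lia); have := b2 k a1 ltac:(lia).
  have := pos_neq kk kk' ne; case: (r); lia.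
move=> kk A r le; have A1 := A r; have A2 := A (~~ r).
have D1 := lo_diag kk; have D2 := hi_diag kk.
have kin : c r <= k0 <= c (~~ r).
  by move: D1 D2 A1 A2 le; case: (r) => /= [] [] ? [] ?; lia.
split=> // m mm ne; have [mk|km] := ltnP m k0.
  apply: (lo_gap (H kk)); lia.
apply: (hi_gap (H kk)); lia.
Qed.
End Positions.

(** * Twisted Baxter permutations *)

Section TwistedBaxter.
Variables (n : nat) (p q r : nat -> nat).
Hypothesis r_in : forall i, i < n -> 1 <= r i <= n.
Hypothesis p_lt : forall j, 1 <= j <= n -> p j < n.
Hypothesis pK : forall j, 1 <= j <= n -> r (p j) = j.
Hypothesis rK : forall i, i < n -> p (r i) = i.
Hypothesis qinj : forall i j, 1 <= i <= n -> 1 <= j <= n -> q i = q j -> i = j.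
Hypothesis baxter : forall a d v w, 1 <= a -> d <= n -> p a = (p d).+1 ->
  a < v < d -> a < w < d -> p v < p d -> p a < p w -> False.
Variables (l h : nat -> bool -> nat).
Hypotheses (Hp : is_boxes n p l h) (Hq : is_boxes n q l h).

(* If no label between d and a in position has its value in (a, d), the word
   between them steps down across (a, d) at some adjacent descent d', a'. *)
Lemma crossing_descent a d : 1 <= a < d -> d <= n -> p d < p a ->
  (forall e, p d < p e < p a -> 1 <= e <= n -> ~~ (a < e < d)) ->
  exists a' d', [/\ 1 <= a' <= a, d <= d' <= n, p a' = (p d').+1, p d <= p d' & p a' <= p a].
Proof.
move=> ad dn pda gap.
have pan : p a < n by apply: p_lt; lia.
have ex : exists i, (p d < i <= p a) && (r i <= a).
  exists (p a); rewrite pK; lia.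
case: (ex_minnP ex) => i hi imin.
have ri := r_in (i := i) ltac:(lia); have ri1 := r_in (i := i.-1) ltac:(lia).
exists (r i), (r i.-1); rewrite !rK; try lia.
suff : d <= r i.-1 by split; lia.
have [e|ne] := eqVneq i.-1 (p d); first by rewrite e pK //; lia.
have := gap (r i.-1); rewrite rK; last lia.
move=> /(_ ltac:(lia) ri1).
have := imin i.-1; lia.
Qed.

(** Either an intermediate label splits the inversion into two with closer positions, or there is a
    crossing descent [d' a']. By avoidance the labels in [(a', d')] are then all before it or all
    after it, and the box of [a] or of [d] records the inversion. *)
Lemma inversion_forced a d : 1 <= a < d -> d <= n -> p d < p a -> q d < q a.
Proof.
have [m] := ubnP (p a - p d); elim: m a d => // m IH a d lem ad dn pda.
have [e|gap] := boolP [exists e : 'I_n.+1, [&& p d < p e, p e < p a & a < e < d]].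
  case/existsP: e => e /and3P[e1 e2 e3].
  by apply: (@ltn_trans (q e)); apply: IH; lia.
have {}gap e : p d < p e < p a -> 1 <= e <= n -> ~~ (a < e < d).
  move=> pe en; have en' : e < n.+1 by lia.
  by move/existsPn: gap => /(_ (Ordinal en')) /=; lia.
have [a' [d' [ha hd pad pd pa]]] := crossing_descent ad dn pda gap.
have pinj i j : 1 <= i <= n -> 1 <= j <= n -> p i = p j -> i = j.
  by move=> ii jj e; rewrite -(pK ii) -(pK jj) e.
have pn := pos_neq pinj.
have Da := Hp (k := a) ltac:(lia); have Dd := Hp (k := d) ltac:(lia).
have Qa := Hq (k := a) ltac:(lia); have Qd := Hq (k := d) ltac:(lia).
have qn := pos_neq qinj (i := a) (j := d) ltac:(lia) ltac:(lia) ltac:(lia).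
(* If one label of [(a', d')] precedes the descent, all do. This excludes [a' < a], and the right
   side of [a] extends at least to [d]. *)
have [|nall] := boolP [exists v : 'I_n.+1, (a' < v < d') && (p v < p d')].
  case/existsP=> v /andP[v1 v2].
  have allb w : a' < w < d' -> p w < p d'.
    move=> ww; have := @baxter a' d' v w ltac:(lia) ltac:(lia) pad v1 ww v2.
    have := pn w d' ltac:(lia) ltac:(lia) ltac:(lia).
    have := pn w a' ltac:(lia) ltac:(lia) ltac:(lia).
    lia.
  have e : a' = a.
    by apply/eqP; apply/negP => /negP ne; have := allb a ltac:(lia); lia.
  have le : d <= h a true.
    apply: leq_trans (_ : d' <= _); first lia.
    apply: (hi_ge_of Da) => [|j jj]; first lia.
    have [->|ne] := eqVneq j d'; first lia.
    by have := allb j ltac:(lia); lia.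
  by have /= := hi_gap Qa (b := true) (j := d) ltac:(lia).
(* Otherwise all follow it, which excludes [d < d'] and puts the left side of [d] before [a]. *)
have alla v : a' < v < d' -> p d' < p v.
  move=> vv; have vn : v < n.+1 by lia.
  move/existsPn: nall => /(_ (Ordinal vn)) /=.
  by have := pn v d' ltac:(lia) ltac:(lia) ltac:(lia); lia.
have e : d' = d.
  by apply/eqP; apply/negP => /negP ne; have := alla d ltac:(lia); lia.
rewrite {}e in ha hd pad pd pa alla {nall}.
have lt : l d true < a'.
  apply: (lo_lt_of Dd) => [|||j jj]; try lia.
  by have := alla j ltac:(lia); lia.
have /= := lo_gap Qd (b := true) (j := a) ltac:(lia); lia.
Qed.

End TwistedBaxter.

(** * From tilings to permutations *)

Section Tiling.
Variables (n : nat) (l h : nat -> bool -> nat).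

(* Unit cells: i is the column from the left and j the row from the top. *)
Definition in_tile k i j := (l k true < i <= h k true) && (l k false < j <= h k false).

Hypothesis tile_lo : forall k b, 1 <= k <= n -> l k b < k.
Hypothesis tile_hi : forall k b, 1 <= k <= n -> k <= h k b <= n.
Hypothesis tile_lo_diag : forall k, 1 <= k <= n -> l k true = k.-1 \/ l k false = k.-1.
Hypothesis tile_hi_diag : forall k, 1 <= k <= n -> h k true = k \/ h k false = k.
Hypothesis tile_cover : forall i j, 1 <= i <= n -> 1 <= j <= n ->
  exists2 k, 1 <= k <= n & in_tile k i j.
Hypothesis tile_disj : forall i j k k', 1 <= k <= n -> 1 <= k' <= n ->
  in_tile k i j -> in_tile k' i j -> k = k'.

Lemma tile_diag k : 1 <= k <= n -> in_tile k k k.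
Proof.
move=> kk; rewrite /in_tile.
by have := tile_lo true kk; have := tile_lo false kk;
  have := tile_hi true kk; have := tile_hi false kk; lia.
Qed.

Lemma tile_diag_only m k : 1 <= m <= n -> 1 <= k <= n -> in_tile m k k -> m = k.
Proof. by move=> mm kk /tile_disj; apply=> //; apply: tile_diag. Qed.

(** With [m] outside this range, a tile containing the cells [(m, m)] and [(i, j)] would also
    contain the diagonal cell of [i] or of [j]. *)
Lemma tile_between m i j : 1 <= m <= n -> 1 <= i <= n -> 1 <= j <= n -> in_tile m i j ->
  minn i j <= m <= maxn i j.
Proof.
move=> mm ii jj mij; have := tile_diag mm.
move: (mij); rewrite /in_tile => A B.
apply/negP => /negP nb.
have [e|e] : minn i j = i \/ minn i j = j by lia.
  have := @tile_diag_only m i mm ii; have := @tile_diag_only m j mm jj.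
  by rewrite /in_tile; lia.
have := @tile_diag_only m i mm ii; have := @tile_diag_only m j mm jj.
by rewrite /in_tile; lia.
Qed.

Definition covered (s : seq nat) i j := has (fun k => in_tile k i j) s.

(** Closed under moves to the left and downwards: rows are counted from the top, so going down
    increases [j]. *)
Definition down_closed (s : seq nat) := forall i j i' j',
  covered s i j -> 1 <= i' <= i -> j <= j' <= n -> covered s i' j'.

Definition distinct_labels (s : seq nat) := uniq s /\ {in s, forall k, 1 <= k <= n}.

Lemma coveredE s i j k : distinct_labels s -> 1 <= k <= n -> in_tile k i j -> covered s i j = (k \in s).
Proof.
move=> [_ sn] kk kij; apply/hasP/idP => [[m ms mij]|ks]; last by exists k.
by rewrite (tile_disj kk (sn _ ms) kij mij).
Qed.

Definition left_ok s k := forall j, l k false < j <= h k false -> 0 < l k true ->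
  covered s (l k true) j.
Definition bottom_ok s k := forall i, l k true < i <= h k true -> h k false < n ->
  covered s i (h k false).+1.

(** An undrawn tile with leftmost left side will do: a tile across that side starts further left,
    hence is drawn. *)
Lemma ex_left_ok s : distinct_labels s -> (exists2 k, 1 <= k <= n & k \notin s) ->
  exists k, [/\ 1 <= k <= n, k \notin s & left_ok s k].
Proof.
move=> vs [k0 k0n k0s].
have ex : exists x, [exists k : 'I_n.+1, [&& 0 < k, (k : nat) \notin s & l k true == x]].
  exists (l k0 true); apply/existsP.
  have k0n' : k0 < n.+1 by lia.
  by exists (Ordinal k0n'); rewrite /= eqxx k0s; lia.
case: (ex_minnP ex) => x /existsP[k /and3P[k1 ks /eqP kx]] xmin.
have kn : 1 <= k <= n by have := ltn_ord k; lia.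
exists (k : nat); split=> // j jj l0.
have [m mm mij] := @tile_cover (l k true) j ltac:(have := tile_lo true kn; lia)
  ltac:(have := tile_hi false kn; lia).
rewrite (coveredE vs mm mij); apply/negP => /negP ms.
have mn : m < n.+1 by lia.
have : x <= l m true.
  by apply: xmin; apply/existsP; exists (Ordinal mn); rewrite /= ms eqxx; lia.
by move: mij; rewrite /in_tile; lia.
Qed.

(* Among the undrawn tiles whose left side is covered, one with lowest bottom
   side can be drawn: an undrawn cell just below it would belong to an undrawn
   tile which has its left side covered and reaches lower. *)
Lemma ex_ok s : distinct_labels s -> down_closed s -> (exists2 k, 1 <= k <= n & k \notin s) ->
  exists k, [/\ 1 <= k <= n, k \notin s, left_ok s k & bottom_ok s k].
Proof.
move=> vs ds /(ex_left_ok vs) [k [kn ks kl]].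
have [m] := ubnP (n - h k false); elim: m k kn ks kl => // m IH k kn ks kl hm.
have [ok|] := boolP [forall i : 'I_n.+1, (l k true < i <= h k true) ==> (h k false < n) ==>
    covered s i (h k false).+1].
  exists k; split=> // i ii hn; have iN : i < n.+1 by have := tile_hi true kn; lia.
  by move/forallP: ok => /(_ (Ordinal iN)); rewrite /= ii hn.
rewrite negb_forall => /existsP[i0]; rewrite !negb_imply => /and3P[i0k hn i0c].
have ex : exists i, (l k true < i <= h k true) && ~~ covered s i (h k false).+1.
  by exists (i0 : nat); rewrite i0k.
(* The tile [m'] at the leftmost undrawn cell below [k] has its top left corner there: above the
   cell is [k], and on its left a covered cell or the edge. Closure then covers its whole left
   side. *)
case: (ex_minnP ex) => c /andP[ck cc] cmin {i0 i0k i0c ex}.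
have hkt := tile_hi true kn; have hkf := tile_hi false kn.
have ltk := tile_lo true kn; have lfk := tile_lo false kn.
have [m' mn mc] := @tile_cover c (h k false).+1 ltac:(lia) ltac:(lia).
rewrite (coveredE vs mn mc) in cc.
have ne : m' <> k by move=> e; move: mc; rewrite e /in_tile; lia.
have lm : l m' false = h k false.
  have := @tile_disj c (h k false) m' k mn kn.
  by move: mc; rewrite /in_tile; lia.
have left1 : 0 < c.-1 -> covered s c.-1 (h k false).+1.
  move=> c1; have [e|ne'] := eqVneq c.-1 (l k true).
    rewrite e; apply: (ds (l k true) (h k false)); [apply: kl|..]; lia.
  by apply/negP => /negP nc; have := cmin c.-1; rewrite nc; lia.
have lmt : l m' true = c.-1.
  have [e|c1] := posnP c.-1; first by move: mc; rewrite /in_tile; lia.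
  apply/eqP; apply/negP => /negP ne'.
  have := left1 c1; rewrite (coveredE vs mn) ?(negbTE cc) //.
  by move: mc; rewrite /in_tile; lia.
apply: (IH m') => //.
  move=> j jj; rewrite lmt => c1; apply: (ds c.-1 (h k false).+1); [exact: left1|lia|].
  by have := tile_hi false mn; lia.
by move: mc; rewrite /in_tile; lia.
Qed.

(** A move left or down out of the new tile crosses its left or bottom side, beyond which the cells
    are already covered. *)
Lemma down_closed_rcons s k : 1 <= k <= n -> down_closed s -> left_ok s k -> bottom_ok s k ->
  down_closed (rcons s k).
Proof.
move=> kn ds kl kb.
have step1 i j i' : covered (rcons s k) i j -> j <= n -> 1 <= i' <= i -> covered (rcons s k) i' j.
  rewrite /covered !has_rcons => /orP[kij|c] jn ii'; last first.
    by apply/orP; right; apply: (ds i j) => //; lia.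
  have [lt|ge] := ltnP (l k true) i'; first by move: kij; rewrite /in_tile; lia.
  apply/orP; right; apply: (ds (l k true) j); [apply: kl|..]; move: kij; rewrite /in_tile; lia.
have step2 i j j' : covered (rcons s k) i j -> 0 < i -> j <= j' <= n -> covered (rcons s k) i j'.
  rewrite /covered !has_rcons => /orP[kij|c] jn ii'; last first.
    by apply/orP; right; apply: (ds i j) => //; lia.
  have [le|gt] := leqP j' (h k false); first by move: kij; rewrite /in_tile; lia.
  apply/orP; right; apply: (ds i (h k false).+1); [apply: kb|..]; move: kij; rewrite /in_tile; lia.
by move=> i j i' j' c ii jj; apply: step1 (_ : covered _ i j') _ _; [apply: step2 c _ _|..]; lia.
Qed.

(** A label is drawn exactly when its diagonal cell is covered. By closure to the left and
    downwards, diagonal cells are compared with cells of the tile or just across its sides. *)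
Lemma tile_is_box s k : distinct_labels s -> 1 <= k <= n -> k \notin s -> down_closed s ->
  left_ok s k -> bottom_ok s k -> is_box n (mem s) k (l k) (h k).
Proof.
move=> vs kn ks ds kl kb.
have hkt := tile_hi true kn; have hkf := tile_hi false kn.
have ltk := tile_lo true kn; have lfk := tile_lo false kn.
have dl := tile_lo_diag kn; have dh := tile_hi_diag kn.
have cd i : 1 <= i <= n -> covered s i i = (i \in s).
  by move=> ii; apply: coveredE => //; apply: tile_diag.
have ck i j : in_tile k i j -> covered s i j = false.
  by move=> kij; rewrite (coveredE vs kn kij); apply: negbTE.
(* The tile next to a side of the k-th tile, on the row or column of k, has
   its label just beyond that side. *)
have nbr i : 1 <= i <= n -> ~~ in_tile k i k ->
  (forall m, minn i k < m < maxn i k -> in_tile k m k) -> covered s i k = (i \in s).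
  move=> ii nk gap; have [m mn mij] := tile_cover ii kn.
  rewrite (coveredE vs mn mij); suff e : m = i by rewrite e.
  have mb := tile_between mn ii kn mij.
  have mk : m != k by apply: contraNneq nk => e; rewrite -{1}e.
  have := tile_diag mn; have := tile_diag kn.
  by move: mij mk (gap m) (@tile_disj m k m k mn kn); rewrite /in_tile; lia.
have nbc j : 1 <= j <= n -> ~~ in_tile k k j ->
  (forall m, minn k j < m < maxn k j -> in_tile k k m) -> covered s k j = (j \in s).
  move=> jj nk gap; have [m mn mij] := tile_cover kn jj.
  rewrite (coveredE vs mn mij); suff e : m = j by rewrite e.
  have mb := tile_between mn kn jj mij.
  have mk : m != k by apply: contraNneq nk => e; rewrite -{1}e.
  have := tile_diag mn; have := tile_diag kn.
  by move: mij mk (gap m) (@tile_disj k m m k mn kn); rewrite /in_tile; lia.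
move=> b; split; split.
- by case: b; lia.
- have [->|lpos] := posnP (l k b); [by left|right]; case: b lpos => lpos.
    have := kl k ltac:(lia) lpos.
    rewrite nbr //; [lia | rewrite /in_tile; lia | move=> m mm; rewrite /in_tile; lia].
  have : ~~ covered s k (l k false).
    apply/negP => c; have := ds _ _ k k c ltac:(lia) ltac:(lia).
    by rewrite cd // (negbTE ks).
  rewrite nbc; [exact: negbTE | lia | rewrite /in_tile; lia | move=> m mm; rewrite /in_tile; lia].
- move=> j jj; case: b jj => jj.
    apply/negP => js; have := ck j k ltac:(rewrite /in_tile; lia).
    by rewrite (ds j j) ?cd //; lia.
  have e : l k true = k.-1 by lia.
  have := kl j ltac:(lia) ltac:(lia); rewrite e => c.
  by have := ds _ _ j j c ltac:(lia) ltac:(lia); rewrite cd //; lia.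
- by case: b; lia.
- have [->|hlt] := eqVneq (h k b) n; [by left|right]; case: b hlt => hlt.
    have : ~~ covered s (h k true).+1 k.
      apply/negP => c; have := ds _ _ k k c ltac:(lia) ltac:(lia).
      by rewrite cd // (negbTE ks).
    rewrite nbr; [exact: negbTE | lia | rewrite /in_tile; lia | move=> m mm; rewrite /in_tile; lia].
  have := kb k ltac:(lia) ltac:(lia).
  rewrite nbc //; [lia | rewrite /in_tile; lia | move=> m mm; rewrite /in_tile; lia].
- move=> j jj; case: b jj => jj.
    have e : h k false = k by lia.
    have := kb j ltac:(lia) ltac:(lia); rewrite e => c.
    by have := ds _ _ j j c ltac:(lia) ltac:(lia); rewrite cd //; lia.
  apply/negP => js; have := ck k j ltac:(rewrite /in_tile; lia).
  by rewrite (ds j j) ?cd //; lia.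
Qed.

(** The word is an order of drawing in which each tile comes after its left and lower neighbours. *)
Theorem tiling_word : exists w, perm_eq w (iota 1 n) /\
  forall s1 k s2, w = s1 ++ k :: s2 -> is_box n (mem s1) k (l k) (h k).
Proof.
suff [w [wsz vw _ W]] : exists w, [/\ size w = n, distinct_labels w, down_closed w &
    forall s1 k s2, w = s1 ++ k :: s2 -> is_box n (mem s1) k (l k) (h k)].
  exists w; split=> //; case: vw => uw wn.
  apply: uniq_perm => //; first exact: iota_uniq.
  have sub : {subset w <= iota 1 n} by move=> k /wn; rewrite mem_iota; lia.
  by have [] := uniq_min_size uw sub; rewrite ?size_iota ?wsz.
suff H m : m <= n -> exists w, [/\ size w = m, distinct_labels w, down_closed w &
    forall s1 k s2, w = s1 ++ k :: s2 -> is_box n (mem s1) k (l k) (h k)].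
  exact: H.
elim: m => [_|m IH mn]; first by exists [::]; split=> // [[]].
have [s [sz vs ds S]] := IH ltac:(lia).
have ex : exists2 k, 1 <= k <= n & k \notin s.
  have [/allP sub|/allPn[k]] := boolP (all (mem s) (iota 1 n)).
    have := uniq_leq_size (iota_uniq 1 n) (sub : {subset _ <= s}); rewrite size_iota sz; lia.
  by rewrite mem_iota => ? ?; exists k => //; lia.
have [k [kn ks kl kb]] := ex_ok vs ds ex.
exists (rcons s k); split.
- by rewrite size_rcons sz.
- case: vs => us sn; split; first by rewrite rcons_uniq ks.
  by move=> j; rewrite mem_rcons inE => /orP[/eqP ->|/sn].
- exact: down_closed_rcons.
move=> s1 j s2; case/lastP: s2 => [|s2 y].
  rewrite cats1 => /rcons_inj[<- <-]; exact: tile_is_box.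
by rewrite -rcons_cons -rcons_cat => /rcons_inj[e _]; apply: S e.
Qed.
End Tiling.

(** * Segments, sides and walls *)

Section Geometry.
Import Order.TTheory GRing.Theory Num.Theory.
Local Open Scope ring_scope.

Lemma seq_avoid_itv (R : realType) (B : seq R) (s t : R) : s < t ->
  exists s' t', [/\ s <= s', s' < t', t' <= t & forall u, s' < u < t' -> u \notin B].
Proof.
move=> st; elim: B => [|x B [s' [t' [h1 h2 h3 h4]]]]; first by exists s, t.
have [/andP[sx xt]|nx] := boolP (s' < x < t').
  exists s', x; split=> // [|u ux]; first lra.
  rewrite inE negb_or h4 ?andbT; last lra.
  by apply/eqP; lra.
exists s', t'; split=> // u ut; rewrite inE negb_or h4 // andbT.
by apply: contraNneq nx => <-.
Qed.

Lemma seq_avoid (R : realType) (B : seq R) (s t : R) : s < t ->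
  exists2 u, s < u < t & u \notin B.
Proof.
move=> /(seq_avoid_itv B) [s' [t' [h1 h2 h3 h4]]].
exists ((s' + t') / 2); first lra.
apply: h4; lra.
Qed.

Lemma seq_max (R : realType) (B : seq R) (P : R -> Prop) x : x \in B -> P x ->
  exists y, [/\ y \in B, P y & forall z, z \in B -> P z -> z <= y].
Proof.
elim: B x => // a B IH x.
have [[y yB Py]|nex] := pselect (exists2 y, y \in B & P y); last first.
  rewrite inE => /orP[/eqP ->|xB] Px; last by case: nex; exists x.
  exists a; split=> //; first exact: mem_head.
  by move=> z; rewrite inE => /orP[/eqP ->//|zB] Pz; case: nex; exists z.
move=> _ _; have [m [mB Pm mmax]] := IH y yB Py.
have [[Pa am]|na] := pselect (P a /\ m < a).
  exists a; split=> //; first exact: mem_head.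
  by move=> z; rewrite inE => /orP[/eqP ->//|zB] Pz; apply/ltW/(le_lt_trans (mmax z zB Pz)).
exists m; split=> //; first by rewrite inE mB orbT.
move=> z; rewrite inE => /orP[/eqP ->|zB] Pz; last exact: mmax.
by rewrite leNgt; apply/negP => ?; apply: na.
Qed.

(** * Coordinates adapted to the diagonal, and axis-parallel segments *)

Section Coordinates.
Variables (R : realType) (n : nat).
Implicit Types (q u v : point R) (r : rectangle R) (b : bool) (c s t : R).

(* Coordinates in which the diagonal of [0, n] x [0, n] is U = V: reflection in
   the diagonal exchanges them, so that vertical ([b = true]) and horizontal
   ([b = false]) segments can be treated alike. *)
Definition co b q : R := if b then q.1 else n%:R - q.2.

Definition pt b c s : point R := if b then (c, n%:R - s) else (s, n%:R - c).

Lemma co_pt b c s : co b (pt b c s) = c.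
Proof. by case: b; rewrite /= ?subKr. Qed.

Lemma co_ptN b c s : co (~~ b) (pt b c s) = s.
Proof. by case: b; rewrite /= ?subKr. Qed.

Lemma co_inj u v b : co b u = co b v -> co (~~ b) u = co (~~ b) v -> u = v.
Proof.
case: u v b => [u1 u2] [v1 v2] [] /= h1 h2; congr (_, _); lra.
Qed.

Lemma pt_co b q : pt b (co b q) (co (~~ b) q) = q.
Proof. by apply: (@co_inj _ _ b); rewrite ?co_pt ?co_ptN. Qed.

Lemma co_between b u v t : co b (between u v t) = (1 - t) * co b u + t * co b v.
Proof. by case: b => //=; rewrite /=; ring. Qed.

Lemma regionE r q : region r q <-> forall b, co b (tl r) <= co b q <= co b (br r).
Proof.
rewrite /region /=; split=> [[h1 h2] []|h]; rewrite /=; first lra.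
  lra.
have := h true; have := h false; rewrite /= => h1 h2; lra.
Qed.

Lemma interiorE r q :
  rect_interior r q <-> forall b, co b (tl r) < co b q < co b (br r).
Proof.
rewrite /rect_interior /=; split=> [[h1 h2] []|h]; rewrite /=; first lra.
  lra.
have := h true; have := h false; rewrite /= => h1 h2; lra.
Qed.

Lemma properE r : proper r <-> forall b, co b (tl r) < co b (br r).
Proof.
rewrite /proper /=; split=> [[h1 h2] []|h]; rewrite /=; first lra.
  lra.
have := h true; have := h false; rewrite /= => h1 h2; lra.
Qed.

(** [b] selects the coordinate that is constant along the side, [c] is its value and [s] the running
    coordinate. *)
Definition on_side r b c s : Prop :=
  (c = co b (tl r) \/ c = co b (br r)) /\ co (~~ b) (tl r) <= s <= co (~~ b) (br r).

Lemma boundary_on_side r q :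
  boundary r q -> exists b, on_side r b (co b q) (co (~~ b) q).
Proof.
move=> [/regionE rq nq].
have [h|] := pselect (forall b, co b q <> co b (tl r) /\ co b q <> co b (br r)).
  case: nq; apply/interiorE => b; have [h1 h2] := h b; have := rq b => /andP[h3 h4].
  by rewrite !lt_neqAle h3 h4 !andbT eq_sym; apply/andP; split; apply/eqP.
move=> /existsNP[b /not_andP h]; exists b; split; last exact: rq.
by case: h => /contrapT; [left|right].
Qed.

Lemma on_side_boundary r b c s : proper r -> on_side r b c s -> boundary r (pt b c s).
Proof.
move=> /properE pr [h1 h2]; split.
  apply/regionE => b'; have [->|ne] := eqVneq b' (~~ b); first by rewrite co_ptN.
  have -> : b' = b by case: b b' ne {h1 h2} => [] [].
  by rewrite co_pt; case: h1 (pr b) => ->; lra.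
by move=> /interiorE /(_ b); rewrite co_pt; case: h1 => ->; rewrite ltxx ?andbF.
Qed.

Definition aseg b c s t : set (point R) :=
  [set q | co b q = c /\ s <= co (~~ b) q <= t].

Lemma aseg_pt b c s t x : s <= x <= t -> aseg b c s t (pt b c x).
Proof. by move=> h; split; rewrite ?co_pt ?co_ptN. Qed.

Lemma asegE b c s t q : aseg b c s t q -> q = pt b c (co (~~ b) q).
Proof. by move=> [<- _]; rewrite pt_co. Qed.

Lemma seg_sym u v : seg u v = seg v u.
Proof.
have H (w1 w2 : point R) q : seg w1 w2 q -> seg w2 w1 q.
  move=> [x [x01 ->]]; exists (1 - x); split; first lra.
  by rewrite /between; congr (_, _); ring.
by apply/seteqP; split=> q; apply: H.
Qed.

Lemma between_onto (s t x : R) : s < t -> x = (1 - (x - s) / (t - s)) * s + (x - s) / (t - s) * t.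
Proof. by move=> st; field; lra. Qed.

Lemma seg_aseg u v b : co b u = co b v -> co (~~ b) u < co (~~ b) v ->
  seg u v = aseg b (co b u) (co (~~ b) u) (co (~~ b) v).
Proof.
move=> e lt; apply/seteqP; split=> q.
  move=> [x [x01 ->]]; rewrite /aseg /= !co_between -e; split; first ring.
  nra.
move=> [h1 h2]; exists ((co (~~ b) q - co (~~ b) u) / (co (~~ b) v - co (~~ b) u)); split.
  apply/andP; split; first by apply: divr_ge0; lra.
  by rewrite ler_pdivrMr; lra.
apply: (@co_inj _ _ b); rewrite co_between; last exact: between_onto.
by rewrite -e h1; ring.
Qed.

Lemma aseg_seg b c s t : s < t -> aseg b c s t = seg (pt b c s) (pt b c t).
Proof. by move=> st; rewrite (@seg_aseg _ _ b) !(co_pt, co_ptN). Qed.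

Lemma pt_neq b c s t : s < t -> pt b c s <> pt b c t.
Proof. by move=> st e; have := co_ptN b c s; rewrite e co_ptN => ?; lra. Qed.

Lemma aseg_is_segment b c s t : s < t -> is_segment (aseg b c s t).
Proof. by move=> st; exists (pt b c s), (pt b c t); split; [apply: pt_neq|apply: aseg_seg]. Qed.

Lemma seg_axis u v b : u <> v -> co b u = co b v ->
  exists s t, s < t /\ seg u v = aseg b (co b u) s t.
Proof.
move=> ne e; have [lt|gt|e'] := ltgtP (co (~~ b) u) (co (~~ b) v).
- by exists (co (~~ b) u), (co (~~ b) v); split=> //; apply: seg_aseg.
- exists (co (~~ b) v), (co (~~ b) u); split=> //; rewrite seg_sym e; exact: seg_aseg.
- by case: ne; apply: co_inj e'.
Qed.

Lemma seg_ends u v : seg u v u /\ seg u v v.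
Proof.
split; [exists 0 | exists 1]; (split; first lra);
  by case: u v => [u1 u2] [v1 v2]; rewrite /between /=; congr (_, _); ring.
Qed.

Lemma seg_interior_aseg b c s t q : s < t ->
  (seg_interior (aseg b c s t) q <-> co b q = c /\ s < co (~~ b) q < t).
Proof.
move=> st; split=> [[u [v [ne e [x [x01 ->]]]]]|[h1 h2]].
  have [] := seg_ends u v; rewrite -e => [[u1 u2] [v1 v2]].
  have ne' : co (~~ b) u != co (~~ b) v.
    by apply/eqP => e'; case: ne; apply: (@co_inj _ _ b) => //; rewrite u1 v1.
  rewrite !co_between u1 v1; split; first ring.
  have [lt|gt|e'] := ltgtP (co (~~ b) u) (co (~~ b) v); last by rewrite e' eqxx in ne'.
    by nra.
  by nra.
exists (pt b c s), (pt b c t); split; [exact: pt_neq|exact: aseg_seg|].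
exists ((co (~~ b) q - s) / (t - s)); split.
  apply/andP; split; first by apply: divr_gt0; lra.
  by rewrite ltr_pdivrMr; lra.
apply: (@co_inj _ _ b); rewrite co_between !(co_pt, co_ptN) ?h1; first by ring.
exact: between_onto.
Qed.

Lemma aseg_sub b b' c c' s t s' t' : s < t -> aseg b c s t `<=` aseg b' c' s' t' ->
  [/\ b' = b, c' = c, s' <= s & t <= t'].
Proof.
move=> st sub.
have [h1 h2] := sub _ (@aseg_pt b c s t s ltac:(lra)).
have [h3 h4] := sub _ (@aseg_pt b c s t t ltac:(lra)).
have eb : b' = b.
  apply: contrapT => ne; have e : b' = ~~ b by case: b b' ne {sub h1 h2 h3 h4} => [] [].
  by move: h1 h3; rewrite e !co_ptN; lra.
by move: h1 h2 h3 h4; rewrite eb !co_pt !co_ptN; split=> //; lra.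
Qed.

(** * Segments contained in the boundaries of rectangles on a finite grid *)

Section Grid.
Variables (D : set (rectangle R)) (G : seq R).
Hypothesis properD : forall r, D r -> proper r.
Hypothesis gridP : forall r b, D r -> co b (tl r) \in G /\ co b (br r) \in G.

(** On a perpendicular side, [s] would be the constant coordinate, hence in the grid. *)
Lemma boundaries_off_grid b c s : s \notin G -> boundaries D (pt b c s) ->
  exists2 r, D r & on_side r b c s.
Proof.
move=> sG [r Dr /boundary_on_side [b' h]]; exists r => //.
have [e|ne] := eqVneq b' b; first by move: h; rewrite e co_pt co_ptN.
have e : b' = ~~ b by case: b b' ne {h} => [] [].
move: h; rewrite e co_ptN => -[h _]; have [g1 g2] := gridP (~~ b) Dr.
by case: h => h; move: sG; rewrite h ?g1 ?g2.
Qed.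

(** A slanted segment meets the finitely many grid lines in finitely many points only. *)
Lemma segment_in_boundaries L : is_segment L -> L `<=` boundaries D ->
  exists b c s t, s < t /\ L = aseg b c s t.
Proof.
move=> [u [v [ne ->]]] sub.
have [[b e]|nax] := pselect (exists b, co b u = co b v).
  by have [s [t [st e']]] := seg_axis ne e; exists b, (co b u), s, t.
have ne' b : co b v - co b u != 0.
  by rewrite subr_eq0; apply/eqP => e; apply: nax; exists b.
(* The parameters at which the line through [u] and [v] meets the grid lines for the coordinate
   [b]. *)
pose B b := [seq (g - co b u) / (co b v - co b u) | g <- G].
have [x x01 xB] := @seq_avoid R (B true ++ B false) 0 1 ltr01.
have [r Dr] : boundaries D (between u v x) by apply: sub; exists x; split=> //; lra.
move=> /boundary_on_side [b [h _]].
have xBb : x \notin B b by move: xB; rewrite mem_cat negb_or => /andP[? ?]; case: (b).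
have [g1 g2] := gridP b Dr.
have : co b (between u v x) \in G by case: h => ->.
move=> g; case/negP: xBb; apply/mapP; exists (co b (between u v x)) => //.
by rewrite co_between; field.
Qed.

(* The endpoints of a maximal segment are sought among the finitely many grid
   coordinates: beyond the last good one the segment cannot extend, for a point
   of it off the grid lies on a side of some rectangle, all of which is good. *)
Lemma maximal_aseg b c s t : s < t -> s \in G -> t \in G -> aseg b c s t `<=` boundaries D ->
  exists s' t', [/\ s' <= s, t <= t', aseg b c s' t' `<=` boundaries D &
    forall s2 t2, s2 <= s' -> t' <= t2 -> aseg b c s2 t2 `<=` boundaries D -> s2 = s' /\ t2 = t'].
Proof.
move=> st sG tG sub.
have [t' [t'G [tt' sub'] tmax]] := @seq_max R G
  (fun x => t <= x /\ aseg b c s x `<=` boundaries D) t tG (conj (lexx _) sub).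
(* The lower end is minimised by maximising its opposite over the negated grid. *)
have [s' [s'G [ss' sub''] smax]] := @seq_max R [seq - g | g <- G]
  (fun x => - x <= s /\ aseg b c (- x) t' `<=` boundaries D) (- s)
  (map_f _ sG) ltac:(by rewrite /= opprK; split).
exists (- s'), t'; split=> // s2 t2 h1 h2 sub2.
have on_side_bd r x y : D r -> on_side r b c x ->
    co (~~ b) (tl r) <= y <= co (~~ b) (br r) -> boundaries D (pt b c y).
  by move=> Dr [h _] hy; exists r => //; apply: on_side_boundary; [exact: properD|split].
split; apply/eqP; rewrite eq_le ?h1 ?h2 ?andbT /= leNgt; apply/negP => lt.
  have [x hx xG] := seq_avoid G lt.
  have [r Dr sd] := boundaries_off_grid xG (sub2 _ (@aseg_pt b c s2 t2 x ltac:(lra))).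
  have [_ hr] := sd; have [g1 _] := gridP (~~ b) Dr.
  have := smax _ (map_f _ g1); rewrite !opprK => H.
  suff : - co (~~ b) (tl r) <= s' by lra.
  apply: H; split; first lra.
  move=> q hq; rewrite (asegE hq); case: hq => _ hq.
  have [le|gt] := leP (co (~~ b) q) x; first by apply: on_side_bd sd _ => //; lra.
  by apply: sub2; apply: aseg_pt; lra.
have [x hx xG] := seq_avoid G lt.
have [r Dr sd] := boundaries_off_grid xG (sub2 _ (@aseg_pt b c s2 t2 x ltac:(lra))).
have [_ hr] := sd; have [_ g1] := gridP (~~ b) Dr.
suff : co (~~ b) (br r) <= t' by lra.
apply: tmax => //; split; first lra.
move=> q hq; rewrite (asegE hq); case: hq => _ hq.
have [le|gt] := leP x (co (~~ b) q); first by apply: on_side_bd sd _ => //; lra.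
by apply: sub2; apply: aseg_pt; lra.
Qed.
End Grid.

Lemma grid_ex (D : set (rectangle R)) : finite_set D ->
  exists G : seq R, forall r b, D r -> co b (tl r) \in G /\ co b (br r) \in G.
Proof.
move=> fD.
have H (f : rectangle R -> R) : exists G : seq R, forall r, D r -> f r \in G.
  have /finite_seqP[G e] := finite_image f fD; exists G => r Dr.
  by (have : (f @` D) (f r) by exists r); rewrite e.
have [G1 h1] := H (fun r => co true (tl r)); have [G2 h2] := H (fun r => co false (tl r)).
have [G3 h3] := H (fun r => co true (br r)); have [G4 h4] := H (fun r => co false (br r)).
exists (G1 ++ G2 ++ G3 ++ G4) => r b Dr; rewrite !mem_cat.
by case: b; rewrite ?h1 ?h2 ?h3 ?h4 ?orbT.
Qed.

End Coordinates.

(** * The boxes of a permutation form a diagonal rectangulation *)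

Lemma unit_interval (R : realType) m (u : R) : 0 <= u < m%:R ->
  exists2 i : nat, (i < m)%N & i%:R <= u < i.+1%:R.
Proof.
elim: m => [|m IH] um; first by lra.
have [lt|ge] := ltP u m%:R.
  by have [|i im ui] := IH _; [lra|exists i => //; lia].
by exists m => //; lra.
Qed.

Section IntegralBoxes.
Variables (R : realType) (n : nat).
Implicit Types (q u v : point R) (b : bool) (c s t : R).
Local Notation S := (int_square R n).
Local Notation co := (@co R n).
Local Notation pt := (@pt R n).
Local Notation aseg := (@aseg R n).

Definition nbox (l h : bool -> nat) : rectangle R :=
  Rectangle (pt true (l true)%:R (l false)%:R) (pt true (h true)%:R (h false)%:R).

Lemma co_tl l h b : co b (tl (nbox l h)) = (l b)%:R.
Proof. by case: b => //=; rewrite subKr. Qed.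
Lemma co_br l h b : co b (br (nbox l h)) = (h b)%:R.
Proof. by case: b => //=; rewrite subKr. Qed.

Lemma co_dpoint i b : co b (dpoint R n i) = i%:R.
Proof. by case: b; rewrite /= ?subKr. Qed.

Lemma co_square b : co b (tl S) = 0 /\ co b (br S) = n%:R.
Proof. by case: b; rewrite /= ?subrr ?subr0. Qed.

Lemma is_edge_aseg b c : (0 < n)%N -> c = 0 \/ c = n%:R -> is_edge S (aseg b c 0 n%:R).
Proof.
move=> n0; have n0R : 0 < n%:R :> R by rewrite ltr0n.
move=> [] ->; rewrite aseg_seg //; case: b; rewrite /is_edge /left_edge /bottom_edge
  /right_edge /top_edge /bl /tr /= ?subr0 ?subrr;
  by [constructor 1|constructor 2|constructor 3|constructor 4].
Qed.

Lemma aseg_is_edge L : (0 < n)%N -> is_edge S L ->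
  exists b c, (c = 0 \/ c = n%:R) /\ L = aseg b c 0 n%:R.
Proof.
move=> n0; have n0R : 0 < n%:R :> R by rewrite ltr0n.
have e1 : n%:R - n%:R = 0 :> R by rewrite subrr.
have e2 : n%:R - 0 = n%:R :> R by rewrite subr0.
case=> ->.
- by exists true, 0; split; [left|rewrite aseg_seg //= e1 e2].
- by exists false, n%:R; split; [right|rewrite aseg_seg //= e1].
- by exists true, n%:R; split; [right|rewrite aseg_seg //= e1 e2].
- by exists false, 0; split; [left|rewrite aseg_seg //= e2].
Qed.

End IntegralBoxes.

Section BoxesOfPermutation.
Variables (R : realType) (n : nat) (p : nat -> nat).
Hypothesis n_gt0 : (0 < n)%N.
Hypothesis pinj : forall i j, (1 <= i <= n)%N -> (1 <= j <= n)%N -> p i = p j -> i = j.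
Variables (l h : nat -> bool -> nat).
Hypothesis H : is_boxes n p l h.
Local Notation S := (int_square R n).
Local Notation co := (@co R n).
Local Notation pt := (@pt R n).
Local Notation aseg := (@aseg R n).

Definition boxes : set (rectangle R) := [set nbox R n (l k) (h k) | k in [set` iota 1 n]].

Let mem1n k : (k \in iota 1 n) = (1 <= k <= n)%N.
Proof. by rewrite mem_iota add1n ltnS. Qed.

Let boxesP r : boxes r -> exists2 k, (1 <= k <= n)%N & r = nbox R n (l k) (h k).
Proof. by move=> [k]; rewrite /= mem1n => kk <-; exists k. Qed.

Let boxesI k : (1 <= k <= n)%N -> boxes (nbox R n (l k) (h k)).
Proof. by move=> kk; exists k; rewrite //= mem1n. Qed.

Let co_lo k b : co b (tl (nbox R n (l k) (h k))) = (l k b)%:R.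
Proof. exact: co_tl. Qed.
Let co_hi k b : co b (br (nbox R n (l k) (h k))) = (h k b)%:R.
Proof. exact: co_br. Qed.

Lemma boxes_proper r : boxes r -> proper r.
Proof.
move=> /boxesP[k kk ->]; apply/(properE n) => b.
rewrite co_lo co_hi ltr_nat.
by apply: leq_trans (lo_lt (H kk) b) (hi_ge (H kk) b).
Qed.

Definition int_grid : seq R := [seq i%:R | i <- iota 0 n.+1].

Lemma boxes_grid r b : boxes r -> co b (tl r) \in int_grid /\ co b (br r) \in int_grid.
Proof.
move=> /boxesP[k kk ->]; rewrite co_lo co_hi; split; apply: map_f; rewrite mem_iota.
  have := lo_lt (H kk) b; lia.
have := hi_le (H kk) b; lia.
Qed.

Lemma boxes_sub_square r q : boxes r -> region r q -> region S q.
Proof.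
move=> /boxesP[k kk ->] /(regionE n) rq; apply/(regionE n) => b.
have := rq b; rewrite co_lo co_hi; have [-> ->] := co_square R n b.
have : 0 <= (l k b)%:R :> R by [].
have : (h k b)%:R <= n%:R :> R by rewrite ler_nat; apply: hi_le (H kk) b.
lra.
Qed.

Lemma boxes_cover_square q : region S q -> exists2 r, boxes r & region r q.
Proof.
move=> /(regionE n) Sq.
(* Closed cells numbered from 1; a coordinate equal to [n] goes to the last one. *)
have cell b : exists i, (1 <= i <= n)%N /\ i.-1%:R <= co b q <= i%:R.
  have := Sq b; have [-> ->] := co_square R n b => /andP[q0 qn].
  have [lt|ge] := ltP (co b q) n%:R.
    have [i im ui] := @unit_interval _ n (co b q) ltac:(lra).
    by exists i.+1; split; [lia|rewrite /=; lra].
  exists n; split; first lia.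
  have : n.-1%:R <= n%:R :> R by rewrite ler_nat; lia.
  lra.
have [c cP] := choice cell.
have [k kk kc] := boxes_cover pinj H (fun b => (cP b).1).
exists (nbox R n (l k) (h k)); first exact: boxesI.
apply/(regionE n) => b; rewrite co_lo co_hi.
have := (cP b).2; have /andP[k1 k2] := kc b.
have : (l k b)%:R <= (c b).-1%:R :> R by rewrite ler_nat; lia.
have : (c b)%:R <= (h k b)%:R :> R by rewrite ler_nat.
lra.
Qed.

Lemma boxes_disjoint_interiors r r' : boxes r -> boxes r' -> r <> r' ->
  rect_interior r `&` rect_interior r' = set0.
Proof.
move=> /boxesP[k kk ->] /boxesP[k' kk' ->] ne; apply/seteqP; split=> // q.
move=> [/(interiorE n) q1 /(interiorE n) q2]; apply: ne.
(* Half-open cells: a point on a grid line is assigned to the cell after it, which both boxes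
   contain since the point is interior to both. *)
have cell b : exists i, i.-1%:R <= co b q < i%:R /\ (0 < i)%N.
  have := q1 b; rewrite co_lo co_hi => /andP[h1 h2].
  have : (h k b)%:R <= n%:R :> R by rewrite ler_nat; apply: hi_le (H kk) b.
  have : 0 <= (l k b)%:R :> R by [].
  move=> h3 h4; have [i im ui] := @unit_interval _ n (co b q) ltac:(lra).
  by exists i.+1.
have [c cP] := choice cell.
suff -> : k = k' by [].
apply: (@boxes_disjoint n p pinj l h H c) => // b.
  have [] := cP b => /andP[c1 c2] c0.
  have := q1 b; rewrite co_lo co_hi => /andP[h1 h2].
  rewrite -(ltr_nat R) (lt_trans h1) //=.
  have : (c b).-1%:R < (h k b)%:R :> R by lra.
  by rewrite ltr_nat; lia.
have [] := cP b => /andP[c1 c2] c0.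
have := q2 b; rewrite co_lo co_hi => /andP[h1 h2].
rewrite -(ltr_nat R) (lt_trans h1) //=.
have : (c b).-1%:R < (h k' b)%:R :> R by lra.
by rewrite ltr_nat; lia.
Qed.

Lemma boxes_subdivision : subdivision S boxes.
Proof.
split; [|exact: boxes_proper| |exact: boxes_disjoint_interiors].
  by apply: finite_image; apply: finite_seq.
apply/seteqP; split=> q; first by move=> [r Dr]; apply: boxes_sub_square.
by move=> /boxes_cover_square[r Dr rq]; exists r.
Qed.

Lemma edge_in_boundaries b c : c = 0 \/ c = n%:R -> aseg b c 0 n%:R `<=` boundaries boxes.
Proof.
move=> cE q [qc qr].
have [r Dr rq] : exists2 r, boxes r & region r q.
  apply: boxes_cover_square; apply/(regionE n) => b'.
  have [-> ->] := co_square R n b'.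
  have [->|ne] := eqVneq b' (~~ b); first by [].
  have -> : b' = b by case: b b' ne {qc qr} => [] [].
  have : 0 <= n%:R :> R by [].
  by rewrite qc; case: cE => ->; lra.
exists r => //; split=> // /(interiorE n) /(_ b).
have [k kk ->] := boxesP Dr; rewrite co_lo co_hi qc.
have : 0 <= (l k b)%:R :> R by [].
have : (h k b)%:R <= n%:R :> R by rewrite ler_nat; apply: hi_le (H kk) b.
case: cE => ->; lra.
Qed.

(* The wall through the i-th diagonal point is vertical if and only if i comes
   before i + 1.  It consists of the right (or bottom) side of the i-th box and
   the left (or top) side of the next one, which overlap at that point. *)
Definition wall_dir i := (p i < p i.+1)%N.
Definition wall_lo_end i := l i.+1 (~~ wall_dir i).
Definition wall_hi_end i := h i (~~ wall_dir i).
Definition wall_of i : set (point R) :=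
  aseg (wall_dir i) i%:R (wall_lo_end i)%:R (wall_hi_end i)%:R.

Lemma wall_ends i : (0 < i < n)%N -> (wall_lo_end i < i)%N /\ (i < wall_hi_end i)%N.
Proof. by move=> ii; have [] := wall_at pinj H ii. Qed.

Lemma wall_of_boundaries i : (0 < i < n)%N -> wall_of i `<=` boundaries boxes.
Proof.
move=> ii q qW; rewrite (asegE qW); case: qW => _.
set x := co _ q => hx; have [h1 h2 h3 h4] := wall_at pinj H ii.
have Hi := H (k := i) ltac:(lia); have Hi1 := H (k := i.+1) ltac:(lia).
have [le|gt] := leP x i%:R.
  exists (nbox R n (l i.+1) (h i.+1)); first by apply: boxesI; lia.
  apply: on_side_boundary; first by apply: boxes_proper; apply: boxesI; lia.
  split; rewrite !co_lo !co_hi; first by left; rewrite h1.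
  have : i%:R <= (h i.+1 (~~ wall_dir i))%:R :> R.
    by rewrite ler_nat; have := hi_ge Hi1 (~~ wall_dir i); lia.
  by move: hx; rewrite /wall_lo_end; lra.
exists (nbox R n (l i) (h i)); first by apply: boxesI; lia.
apply: on_side_boundary; first by apply: boxes_proper; apply: boxesI; lia.
split; rewrite !co_lo !co_hi; first by right; rewrite h2.
have : (l i (~~ wall_dir i))%:R <= i%:R :> R.
  by rewrite ler_nat; have := lo_lt Hi (~~ wall_dir i); lia.
by move: hx; rewrite /wall_hi_end; lra.
Qed.

Lemma side_on_wall r b i (x : R) : boxes r -> (0 < i < n)%N -> on_side n r b i%:R x ->
  b = wall_dir i /\ (wall_lo_end i)%:R <= x <= (wall_hi_end i)%:R.
Proof.
move=> /boxesP[k kk ->] ii [e hx].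
have [E1 E2 E3] : [/\ b = wall_dir i, (l i.+1 (~~ b) <= l k (~~ b))%N & (h k (~~ b) <= h i (~~ b))%N].
  case: e; rewrite ?co_lo ?co_hi => /eqP; rewrite eqr_nat => /eqP e.
    by apply: (wall_lo pinj H kk); lia.
  by apply: (wall_hi pinj H kk); lia.
split=> //; rewrite /wall_lo_end /wall_hi_end -E1.
move: hx; rewrite co_lo co_hi; move: E2 E3; rewrite -!(ler_nat R); lra.
Qed.

(** Points of the segment off the grid lie on sides of boxes, so [c] is an integer, and for
    [0 < c < n] they stay within one wall. Being dense, they keep the ends from sticking out. *)
Lemma segment_in_wall b c (s t : R) : s < t -> aseg b c s t `<=` boundaries boxes ->
  (c = 0 \/ c = n%:R) /\ aseg b c s t `<=` aseg b c 0 n%:R \/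
  exists i, [/\ (0 < i < n)%N, c = i%:R & aseg b c s t `<=` wall_of i].
Proof.
move=> st sub.
have off x := @boundaries_off_grid R n _ int_grid boxes_grid b c x.
have [x xst xG] := seq_avoid int_grid st.
have [r Dr sd] := off x xG (sub _ (@aseg_pt _ n b c s t x ltac:(lra))).
have [i iN ci] : exists2 i, (i <= n)%N & c = i%:R.
  have [k kk er] := boxesP Dr; case: sd => -[] -> _; rewrite er ?co_lo ?co_hi.
    exists (l k b) => //; have := lo_lt (H kk) b; lia.
  by exists (h k b) => //; apply: hi_le (H kk) b.
have [/andP[i0 ilt]|nii] := boolP (0 < i < n)%N.
  right; exists i; split; [lia|by []|].
  have ii : (0 < i < n)%N by lia.
  have W y : y \notin int_grid -> s <= y <= t ->
    b = wall_dir i /\ (wall_lo_end i)%:R <= y <= (wall_hi_end i)%:R.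
    move=> yG yst; have [r' Dr' sd'] := off y yG (sub _ (@aseg_pt _ n b c s t y yst)).
    by rewrite ci in sd'; apply: side_on_wall sd'.
  have [eb _] := W x xG ltac:(lra).
  have slo : (wall_lo_end i)%:R <= s.
    rewrite leNgt; apply/negP => lt.
    have lt' : s < Num.min t (wall_lo_end i)%:R by rewrite lt_min st lt.
    have [y] := seq_avoid int_grid lt'; rewrite lt_min => /and3P[y1 y2 y3] yG.
    by have [_] := W y yG ltac:(lra); lra.
  have thi : t <= (wall_hi_end i)%:R.
    rewrite leNgt; apply/negP => lt.
    have lt' : Num.max s (wall_hi_end i)%:R < t by rewrite gt_max st lt.
    have [y] := seq_avoid int_grid lt'; rewrite gt_max -andbA => /and3P[y1 y2 y3] yG.
    by have [_] := W y yG ltac:(lra); lra.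
  by move=> q [qc qst]; rewrite /wall_of -eb; split; [rewrite qc|lra].
left; split.
  have [i0|i0] : i = 0%N \/ i = n by lia.
    by left; rewrite ci i0.
  by right; rewrite ci i0.
have bd y : s <= y <= t -> 0 <= y <= n%:R.
  move=> yst; have [r' Dr' [/(boxes_sub_square Dr') + _]] := sub _ (@aseg_pt _ n b c s t y yst).
  by move=> /(regionE n) /(_ (~~ b)); rewrite co_ptN; have [-> ->] := co_square R n (~~ b).
move=> q [qc qst]; split=> //.
exact: bd.
Qed.

(** Every segment in the boundaries is part of an edge or of some [wall_of i], so these are the
    maximal ones. *)
Lemma wallP L : wall S boxes L <-> exists2 i, (0 < i < n)%N & L = wall_of i.
Proof.
have n0R : 0 < n%:R :> R by rewrite ltr0n.
have ends i : (0 < i < n)%N -> (wall_lo_end i)%:R < (wall_hi_end i)%:R :> R.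
  by move=> ii; have [? ?] := wall_ends ii; rewrite ltr_nat; lia.
split=> [[sL Lbd Lmax Ledge]|[i ii ->]].
  have [b [c [s [t [st eL]]]]] := segment_in_boundaries boxes_grid sL Lbd.
  rewrite eL in Lbd; have [[cE sub]|[i [ii ci sub]]] := segment_in_wall st Lbd.
    case: Ledge; rewrite -(Lmax (aseg b c 0 n%:R)); first exact: is_edge_aseg.
    - exact: aseg_is_segment.
    - exact: edge_in_boundaries.
    - by rewrite eL.
  exists i => //; rewrite -(Lmax (wall_of i)) //; last by rewrite eL.
    exact/aseg_is_segment/ends.
  exact: wall_of_boundaries.
split.
- exact/aseg_is_segment/ends.
- exact: wall_of_boundaries.
- move=> L' sL' bd' sub.
  have [b [c [s [t [st eL]]]]] := segment_in_boundaries boxes_grid sL' bd'.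
  rewrite eL in bd' sub *; have [e1 e2 h1 h2] := aseg_sub (ends _ ii) sub.
  have [[cE _]|[j [jj cj sub']]] := segment_in_wall st bd'.
    by move: cE; rewrite e2 => -[] /eqP; rewrite ?pnatr_eq0 ?eqr_nat; lia.
  have ij : i = j by move: cj; rewrite e2 => /eqP; rewrite eqr_nat => /eqP.
  by apply/seteqP; split=> //; rewrite ij.
- move=> /(aseg_is_edge n_gt0) [b [c [cE e]]].
  have sub : wall_of i `<=` aseg b c 0 n%:R by rewrite e.
  have [_ e2 _ _] := aseg_sub (ends _ ii) sub.
  by move: cE; rewrite e2 => -[] /eqP; rewrite ?pnatr_eq0 ?eqr_nat; lia.
Qed.

Lemma wall_of_dpoint i j : (0 < i < n)%N -> (wall_of i (dpoint R n j) <-> i = j).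
Proof.
move=> ii; rewrite /wall_of /aseg /= !co_dpoint; split=> [[/eqP]|<-].
  by rewrite eqr_nat => /eqP.
by have [h1 h2] := wall_ends ii; rewrite !ler_nat; split=> //; lia.
Qed.

Lemma boxes_dRec : dRec R n boxes.
Proof.
have n0R : 0 < n%:R :> R by rewrite ltr0n.
split.
- by split; rewrite /proper /= ?subr0.
- have -> : @int_points R n = dpoint R n @` [set` iota 1 n.-1].
    apply/seteqP; split=> q.
      by move=> [i [ii ->]]; exists i => //=; rewrite mem_iota; lia.
    by move=> [i /=]; rewrite mem_iota => ii <-; exists i; split=> //; lia.
  by apply: finite_image; apply: finite_seq.
- move=> q [i [ii ->]]; exists (i%:R / n%:R).
  have lt : i%:R < n%:R :> R by rewrite ltr_nat; lia.
  have gt : 0 < i%:R :> R by rewrite ltr0n; lia.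
  split; first by rewrite divr_gt0 //= ltr_pdivrMr ?mul1r.
  by rewrite /dpoint /between /=; congr (_, _); field; rewrite gt_eqF.
- exact: boxes_subdivision.
- move=> L L' /wallP[i ii ->] /wallP[j jj ->] ne; apply/seteqP; split=> // q.
  have ends k : (0 < k < n)%N -> (wall_lo_end k)%:R < (wall_hi_end k)%:R :> R.
    by move=> kk; have [? ?] := wall_ends kk; rewrite ltr_nat; lia.
  move=> [/(seg_interior_aseg _ _ _ q (ends _ ii)) [i1 i2] /(seg_interior_aseg _ _ _ q (ends _ jj)) [j1 j2]].
  have [e|nd] := eqVneq (wall_dir j) (wall_dir i).
    by apply: ne; move: i1; rewrite -e j1 => /eqP; rewrite eqr_nat => /eqP ->.
  have ed : wall_dir j = ~~ wall_dir i by move: nd; case: (wall_dir i); case: (wall_dir j).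
  rewrite ed negbK i1 in j2; rewrite ed in j1; rewrite j1 in i2.
  apply: (walls_noncrossing pinj H ii jj ed).
    by move: i2; rewrite !ltr_nat.
  by move: j2; rewrite /wall_lo_end /wall_hi_end ed negbK !ltr_nat.
- move=> L /wallP[i ii ->]; exists (dpoint R n i); first by exists i.
  by apply/wall_of_dpoint.
- move=> q [i [ii ->]]; exists (wall_of i); split.
    by split; [apply/wallP; exists i|apply/wall_of_dpoint].
  by move=> L [/wallP[j jj ->] /(wall_of_dpoint _ jj) ->].
Qed.
End BoxesOfPermutation.
#[global] Arguments boxes : clear implicits.

(** * Diagonal rectangulations are tilings with one tile per label *)

(** [j - 1/2] is the centre of the [j]-th unit cell; the rules reduce comparing centres with grid
    lines to natural numbers. *)
Lemma lt_half (R : realType) (i j : nat) :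
  ((i%:R < j%:R - 2^-1 :> R) = (i < j)%N) * ((i%:R <= j%:R - 2^-1 :> R) = (i < j)%N) *
  ((j%:R - 2^-1 < i%:R :> R) = (j <= i)%N) * ((j%:R - 2^-1 <= i%:R :> R) = (j <= i)%N).
Proof.
have [lt|ge] := ltnP i j.
  have H : i%:R + 1 <= j%:R :> R by rewrite natr1 ler_nat.
  by do !split; apply/idP; lra.
have H : j%:R <= i%:R :> R by rewrite ler_nat.
by do !split; apply/idP; lra.
Qed.

(* The tile meets the diagonal exactly in its k-th unit segment. *)
Definition tile_label (n k : nat) (l h : bool -> nat) : Prop :=
  [/\ forall b, (l b < k <= h b)%N /\ (h b <= n)%N,
      l true = k.-1 \/ l false = k.-1 & h true = k \/ h false = k].

Lemma tile_label_inj n k k' l h : tile_label n k l h -> tile_label n k' l h -> k = k'.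
Proof.
move=> [h1 h2 h3] [h1' h2' h3'].
by have := h1 true; have := h1 false; have := h1' true; have := h1' false; lia.
Qed.

Section RectangulationTiling.
Variables (R : realType) (n : nat) (D : set (rectangle R)).
Hypothesis n_gt0 : (0 < n)%N.
Hypothesis HD : dRec R n D.
Local Notation S := (int_square R n).
Local Notation co := (@co R n).
Local Notation pt := (@pt R n).
Local Notation aseg := (@aseg R n).
Local Notation nbox := (@nbox R n).

Let sub_proper r : D r -> proper r.
Proof. by have [_ H _ _] := dr_subdivision HD; apply: H. Qed.

Let sub_region q : region S q <-> exists2 r, D r & region r q.
Proof. by have [_ _ <- _] := dr_subdivision HD; split=> [[r]|[r]]; exists r. Qed.

Lemma tile_bounds r b : D r -> [/\ 0 <= co b (tl r), co b (tl r) < co b (br r) & co b (br r) <= n%:R].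
Proof.
move=> Dr; have /(properE n) pr := sub_proper Dr; split=> //.
  have /(regionE n) /(_ b) : region S (tl r).
    by apply/sub_region; exists r => //; apply/(regionE n) => b'; rewrite lexx ltW.
  by have [-> _] := co_square R n b => /andP[].
have /(regionE n) /(_ b) : region S (br r).
  by apply/sub_region; exists r => //; apply/(regionE n) => b'; rewrite lexx ltW.
by have [_ ->] := co_square R n b => /andP[].
Qed.

(** A maximal segment containing the side is a wall, since [c] is not the coordinate of an edge. It
    contains a diagonal point, whose two coordinates are the same integer. *)
Lemma side_in_wall r b c : D r -> c = co b (tl r) \/ c = co b (br r) -> 0 < c < n%:R ->
  exists (i : nat) s t, [/\ (0 < i < n)%N, c = i%:R, wall S D (aseg b c s t), s <= i%:R <= t &
    s <= co (~~ b) (tl r) /\ co (~~ b) (br r) <= t].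
Proof.
move=> Dr cE c0n.
have [fD _ _ _] := dr_subdivision HD; have [G gG] := grid_ex n fD.
have [g1 g2] := gG r (~~ b) Dr; have [_ lt _] := tile_bounds (~~ b) Dr.
have sub : aseg b c (co (~~ b) (tl r)) (co (~~ b) (br r)) `<=` boundaries D.
  move=> q qa; rewrite (asegE qa); case: qa => _ hq; exists r => //.
  by apply: on_side_boundary; [exact: sub_proper|split].
have [s [t [hs ht sub' mx]]] := maximal_aseg sub_proper gG lt g1 g2 sub.
have st : s < t by lra.
have W : wall S D (aseg b c s t).
  split=> //; first exact: aseg_is_segment.
    move=> L' sL' bd' sub''.
    have [b' [c' [s' [t' [st' eL]]]]] := segment_in_boundaries gG sL' bd'.
    rewrite eL in bd' sub'' *; have [e1 e2 h1 h2] := aseg_sub st sub''.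
    by rewrite e1 e2 in bd' *; have [-> ->] := mx _ _ h1 h2 bd'.
  move=> /(aseg_is_edge n_gt0) [b' [c' [cE' e]]].
  have : aseg b c s t `<=` aseg b' c' 0 n%:R by rewrite e.
  by move=> /(aseg_sub st) [_ e2 _ _]; move: cE'; rewrite e2 => -[] ?; lra.
have [q [i [ii ->]]] := dr_wall_point HD W.
by rewrite /aseg /= !co_dpoint => -[ic ist]; exists i, s, t; split.
Qed.

Lemma interiors_meet (r r' : rectangle R) x : proper r' -> rect_interior r x -> region r' x ->
  exists q, rect_interior r q /\ rect_interior r' q.
Proof.
move=> /(properE n) pr /(interiorE n) rx /(regionE n) rx'.
have H b : exists y, co b (tl r) < y < co b (br r) /\ co b (tl r') < y < co b (br r').
  have h1 := pr b; have h2 := rx b; have h3 := rx' b.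
  have : Num.max (co b (tl r)) (co b (tl r')) < Num.min (co b (br r)) (co b (br r')).
    by rewrite gt_max !lt_min; apply/andP; split; apply/andP; split; lra.
  move=> /(seq_avoid [::]) [y]; rewrite gt_max lt_min => /andP[/andP[? ?] /andP[? ?]] _.
  by exists y; split; apply/andP.
have [y1 [a1 a2]] := H true; have [y2 [b1 b2]] := H false.
exists (pt true y1 y2); split; apply/(interiorE n) => -[].
- by rewrite co_pt.
- by rewrite (@co_ptN _ n true).
- by rewrite co_pt.
- by rewrite (@co_ptN _ n true).
Qed.

Lemma interiors_meet_eq (r r' : rectangle R) x : D r -> D r' -> rect_interior r x -> region r' x -> r = r'.
Proof.
move=> Dr Dr' rx rx'; apply: contrapT => ne.
have [_ _ _ dj] := dr_subdivision HD.
have [q qq] := interiors_meet (sub_proper Dr') rx rx'.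
by have := dj _ _ Dr Dr' ne; move/seteqP => [/(_ q qq)].
Qed.

(** A wall passes through the point, so it is on the boundary of some tile; disjointness of
    interiors would make this tile [r] itself. *)
Lemma dpoint_not_interior r i : D r -> (0 < i < n)%N -> ~ rect_interior r (dpoint R n i).
Proof.
move=> Dr ii ri.
have [L [[[_ Lbd _ _] Lp] _]] : exists! L, wall S D L /\ L (dpoint R n i).
  by apply: (dr_point_wall HD); exists i.
have [r' Dr' [rr nr]] := Lbd _ Lp.
by have e := interiors_meet_eq Dr Dr' ri rr; rewrite e in ri.
Qed.

(* Otherwise the corner of r on the wrong side of the diagonal would be a
   crossing of the two walls through the sides meeting there, since both walls
   reach the diagonal. *)
Lemma corner_across_diagonal r b : D r -> co (~~ b) (tl r) < co b (br r).
Proof.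
move=> Dr; rewrite ltNge; apply/negP => le.
have [h1 h2 h3] := tile_bounds b Dr; have [h4 h5 h6] := tile_bounds (~~ b) Dr.
have [i [s [t [ii ci W ist [hs ht]]]]] :=
  side_in_wall (b := b) Dr (or_intror erefl) ltac:(lra).
have [j [s' [t' [jj cj W' jst [hs' ht']]]]] :=
  side_in_wall (b := ~~ b) Dr (or_introl erefl) ltac:(lra).
rewrite negbK in hs' ht'.
have ne : aseg b (co b (br r)) s t <> aseg (~~ b) (co (~~ b) (tl r)) s' t'.
  move=> e; have st : s < t by lra.
  have : aseg b (co b (br r)) s t `<=` aseg (~~ b) (co (~~ b) (tl r)) s' t' by rewrite e.
  by move=> /(aseg_sub st) [e1 _ _ _]; case: (b) e1.
(* For [i = j] two different walls would pass through one diagonal point. *)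
have [e|nij] := eqVneq i j.
  have [L [_ Lu]] : exists! L, wall S D L /\ L (dpoint R n i).
    by apply: (dr_point_wall HD); exists i.
  apply: ne; rewrite -(Lu (aseg b (co b (br r)) s t)); last first.
    by split=> //; split; rewrite !co_dpoint.
  by apply: Lu; split=> //; split; rewrite co_dpoint ?e ?cj.
have ij : i%:R < j%:R :> R.
  by rewrite lt_neqAle eqr_nat nij /= -ci -cj.
(* The corner is strictly inside both walls: each contains a side of [r] ending there and, since
   [i < j], has its diagonal point beyond it. *)
set x := pt b (co b (br r)) (co (~~ b) (tl r)).
have := dr_walls_noncrossing HD W W' ne; move/seteqP => [/(_ x) + _]; apply; split.
  by apply/seg_interior_aseg; rewrite /x ?co_pt ?co_ptN; [lra|split=> //; lra].
by apply/seg_interior_aseg; rewrite /x ?negbK ?co_pt ?co_ptN; [lra|split=> //; lra].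
Qed.

Lemma tile_integral r b : D r ->
  (exists2 i, (i <= n)%N & co b (tl r) = i%:R) /\ (exists2 i, (i <= n)%N & co b (br r) = i%:R).
Proof.
move=> Dr; have [h1 h2 h3] := tile_bounds b Dr.
have I c : c = co b (tl r) \/ c = co b (br r) -> exists2 i, (i <= n)%N & c = i%:R.
  move=> cE; have [c0|c0] := eqVneq c 0; first by exists 0%N.
  have [cn|cn] := eqVneq c n%:R; first by exists n.
  have c0n : 0 < c < n%:R.
    by rewrite !lt_neqAle cn eq_sym c0 /=; case: cE => ->; lra.
  by have [i [s [t [ii -> _ _ _]]]] := side_in_wall Dr cE c0n; exists i => //; lia.
by split; apply: I; [left|right].
Qed.

(** The tile enters the diagonal at [maxn (l true) (l false)]; the next diagonal point is not
    interior to it, so the tile leaves the diagonal there. *)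
Lemma tile_labelled r : D r ->
  exists k l h, [/\ (1 <= k <= n)%N, r = nbox l h & tile_label n k l h].
Proof.
move=> Dr.
have [l lP] := choice (fun b => let: conj (ex_intro2 i _ e) _ := tile_integral b Dr in
  ex_intro (fun i : nat => co b (tl r) = i%:R) i e).
have [h hP] := choice (fun b => let: conj _ (ex_intro2 i _ e) := tile_integral b Dr in
  ex_intro (fun i : nat => co b (br r) = i%:R) i e).
have rE : r = nbox l h.
  case: r {Dr} lP hP => rt rb lP hP; rewrite /nbox; congr (Rectangle _ _).
    by rewrite -!lP -{1}(pt_co n true rt).
  by rewrite -!hP -{1}(pt_co n true rb).
have lh b : [/\ (l b < h b)%N, (h b <= n)%N & (l (~~ b) < h b)%N].
  have [_ + +] := tile_bounds b Dr; have := corner_across_diagonal b Dr.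
  by rewrite !lP !hP !ltr_nat ler_nat.
have [a1 a2 a3] := lh true; have [b1 b2 b3] := lh false; rewrite /= in a3 b3.
exists (maxn (l true) (l false)).+1, l, h.
have nd : h true = (maxn (l true) (l false)).+1 \/ h false = (maxn (l true) (l false)).+1.
  have [//|nn] := pselect (h true = (maxn (l true) (l false)).+1 \/ h false = (maxn (l true) (l false)).+1).
  case: (@dpoint_not_interior r (maxn (l true) (l false)).+1 Dr ltac:(lia)).
  apply/(interiorE n) => b; rewrite co_dpoint lP hP !ltr_nat; case: b; lia.
split=> //; first lia.
split=> //; first by case; lia.
by rewrite /=; lia.
Qed.

Lemma point_tile (c : bool -> nat) : (forall b, (1 <= c b <= n)%N) ->
  exists k l h, [/\ (1 <= k <= n)%N, D (nbox l h), tile_label n k l h &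
    forall b, (l b < c b <= h b)%N].
Proof.
move=> cc; pose q := pt true ((c true)%:R - 2^-1) ((c false)%:R - 2^-1).
have qE b : co b q = (c b)%:R - 2^-1.
  by case: b; rewrite /q ?co_pt // (@co_ptN _ n true).
have /sub_region[r Dr /(regionE n) rq] : region S q.
  apply/(regionE n) => b; have [-> ->] := co_square R n b; rewrite qE.
  have := @lt_half R 0 (c b); have := @lt_half R n (c b); have := cc b.
  by move=> ? H1 H2; rewrite H1 (_ : 0 = 0%:R) // H2; lia.
have [k [l [h [kk rE kl]]]] := tile_labelled Dr.
exists k, l, h; split=> //; first by rewrite -rE.
by move=> b; have := rq b; rewrite qE rE co_tl co_br !lt_half.
Qed.

Lemma nbox_inj l h l' h' : nbox l h = nbox l' h' -> l =1 l' /\ h =1 h'.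
Proof.
move=> e; split=> b.
  have := co_tl R n l h b; rewrite e co_tl => /eqP; rewrite eqr_nat => /eqP; by [].
by have := co_br R n l h b; rewrite e co_br => /eqP; rewrite eqr_nat => /eqP.
Qed.

Lemma tiles_meet_eq l h l' h' (c : bool -> nat) : D (nbox l h) -> D (nbox l' h') ->
  (forall b, (l b < c b <= h b)%N) -> (forall b, (l' b < c b <= h' b)%N) ->
  l =1 l' /\ h =1 h'.
Proof.
move=> Dr Dr' h1 h2; apply: nbox_inj.
pose q := pt true ((c true)%:R - 2^-1) ((c false)%:R - 2^-1).
have qE b : co b q = (c b)%:R - 2^-1.
  by case: b; rewrite /q ?co_pt // (@co_ptN _ n true).
apply: (interiors_meet_eq (x := q) Dr Dr').
  by apply/(interiorE n) => b; rewrite qE (co_tl _ _ l h) (co_br _ _ l h) !lt_half.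
by apply/(regionE n) => b; rewrite qE (co_tl _ _ l' h') (co_br _ _ l' h') !lt_half.
Qed.

(** The tile containing the [k]-th diagonal cell has label [k], and every tile arises so; this
    indexes [D] by the labels. *)
Theorem dRec_word : exists w l h, [/\ perm_eq w (iota 1 n),
  forall s1 k s2, w = s1 ++ k :: s2 -> is_box n (mem s1) k (l k) (h k) &
  D = [set nbox (l k) (h k) | k in [set` iota 1 n]]].
Proof.
have ex k : exists lh : (bool -> nat) * (bool -> nat), (1 <= k <= n)%N ->
    D (nbox lh.1 lh.2) /\ tile_label n k lh.1 lh.2.
  (* Dummy sides when [k] is not a label. *)
  have [kk|nk] := boolP (1 <= k <= n)%N; last by exists (fun=> 0%N, fun=> 0%N).
  have [k' [l [h [kk' Dr kl lh]]]] := @point_tile (fun=> k) (fun=> kk).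
  exists (l, h) => _; split=> //=.
  suff -> : k = k' by [].
  case: kl => h1 h2 h3; have := h1 true; have := h1 false; have := lh true; have := lh false.
  lia.
have [lh lhP] := choice ex.
pose l k := (lh k).1; pose h k := (lh k).2.
have lhD k : (1 <= k <= n)%N -> D (nbox (l k) (h k)) by case/lhP.
have lhL k : (1 <= k <= n)%N -> tile_label n k (l k) (h k) by case/lhP.
have DE r : D r -> exists2 k, (1 <= k <= n)%N & r = nbox (l k) (h k).
  move=> Dr; have [k [l' [h' [kk rE kl]]]] := tile_labelled Dr; exists k => //.
  have [h1 _ _] := kl; have [h2 _ _] := lhL k kk.
  rewrite rE in Dr *.
  have [e1 e2] := @tiles_meet_eq l' h' (l k) (h k) (fun=> k) Dr (lhD k kk)
    (fun b => (h1 b).1) (fun b => (h2 b).1).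
  by rewrite (funext e1) (funext e2).
have cellE (i j k : nat) : in_tile l h k i j ->
    forall b, (l k b < (if b then i else j) <= h k b)%N.
  by move=> /andP[? ?] [].
have [w [pw W]] : exists w, perm_eq w (iota 1 n) /\
    forall s1 k s2, w = s1 ++ k :: s2 -> is_box n (mem s1) k (l k) (h k).
  apply: tiling_word.
  - by move=> k b /lhL[/(_ b)]; lia.
  - by move=> k b /lhL[/(_ b)]; lia.
  - by move=> k /lhL[].
  - by move=> k /lhL[].
  - move=> i j ii jj.
    have [k' [l' [h' [kk Dr _ lh']]]] := @point_tile (fun b => if b then i else j)
      ltac:(by case).
    have [k kk' e] := DE _ Dr; have [e1 e2] := nbox_inj e; exists k => //.
    by have := lh' true; have := lh' false; rewrite !e1 !e2 /in_tile => -> ->.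
  - move=> i j k k' kk kk' /cellE c1 /cellE c2.
    have [e1 e2] := tiles_meet_eq (lhD k kk) (lhD k' kk') c1 c2.
    apply: tile_label_inj (lhL k kk) _.
    by rewrite (funext e1) (funext e2); apply: lhL.
exists w, l, h; split=> //.
apply/seteqP; split=> r.
  by move=> /DE[k kk ->]; exists k => //=; rewrite mem_iota; lia.
by move=> [k /=]; rewrite mem_iota => kk <-; apply: lhD; lia.
Qed.
End RectangulationTiling.

(** * The staircases drawn by rho *)

(* [lia] without the hypotheses on real numbers, which would slow it down. *)
Ltac nlia := repeat match goal with
  | H : context [@Order.le _ _ _ _] |- _ => clear H
  | H : context [@Order.lt _ _ _ _] |- _ => clear H
  end; lia.

Section Drawing.
Variables (R : realType) (n : nat).
Hypothesis n_gt0 : (0 < n)%N.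
Local Notation S := (int_square R n).
Local Notation co := (@co R n).
Local Notation pt := (@pt R n).
Local Notation aseg := (@aseg R n).
Local Notation nbox := (@nbox R n).

(* The region below the staircase of the set s of labels drawn so far, together
   with the left and bottom edges of S, which are the blocks of labels {0} and
   {n + 1}.  Its outer corners are at the blocks of consecutive labels of s. *)
Definition stair (s : seq nat) : set (point R) :=
  [set q | region S q /\ exists c d : nat,
    [/\ (c <= d <= n.+1)%N, forall m, (c <= m <= d)%N -> (0 < m <= n)%N -> m \in s,
        c%:R <= co false q + 1 & co true q <= d%:R]].

Lemma stair_nil : stair [::] = left_edge S `|` bottom_edge S.
Proof.
have n0R : 0 < n%:R :> R by rewrite ltr0n.
have -> : left_edge S = aseg true 0 0 n%:R.
  by rewrite aseg_seg //= /left_edge /bl /= subrr subr0.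
have -> : bottom_edge S = aseg false n%:R 0 n%:R.
  by rewrite aseg_seg //= /bottom_edge /bl /= subrr.
have SE q : region S q <-> forall b, 0 <= co b q <= n%:R.
  split=> [/(regionE n) h b|h]; last apply/(regionE n) => b.
    by have := h b; have [-> ->] := co_square R n b.
  by have [-> ->] := co_square R n b.
apply/seteqP; split=> q; last first.
  case=> -[q1 q2]; split.
  - by apply/SE => -[]; rewrite ?q1; lra.
  - exists 0%N, 0%N; rewrite q1; split=> //; first by move=> m; nlia.
    by rewrite addr_ge0 //; move: q2 => /andP[].
  - by apply/SE => -[]; rewrite ?q1; lra.
  - exists n.+1, n.+1; rewrite q1 natr1; split=> //; first nlia.
      by move=> m; nlia.
    by move: q2; rewrite -natr1 /=; lra.
move=> [/SE Sq [c [d [cd mem h1 h2]]]].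
have := Sq true; have := Sq false => q1 q2.
have [c0|c0] := posnP c.
  have d0 : d = 0%N.
    apply/eqP; rewrite -leqn0 leqNgt; apply/negP => d0.
    by have := mem 1%N; rewrite in_nil; nlia.
  by left; split=> //; rewrite d0 in h2; lra.
have cn : c = n.+1.
  by have := mem c; rewrite in_nil; nlia.
by right; split=> //; rewrite cn -natr1 in h1; lra.
Qed.

(** * One step of [rho] on the staircase *)

Section Step.
Variables (s : seq nat) (k : nat) (l h : bool -> nat).
Hypotheses (k_in : (1 <= k <= n)%N) (ks : k \notin s) (H : is_box n (mem s) k l h).

Let SE (q : point R) : region S q <-> forall b, 0 <= co b q <= n%:R.
Proof.
split=> [/(regionE n) h' b|h']; last apply/(regionE n) => b.
  by have := h' b; have [-> ->] := co_square R n b.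
by have [-> ->] := co_square R n b.
Qed.

Let l_lt b : (l b < k)%N. Proof. exact: lo_lt H b. Qed.
Let h_ge b : (k <= h b)%N. Proof. exact: hi_ge H b. Qed.
Let h_le b : (h b <= n)%N. Proof. exact: hi_le H b. Qed.
Let lT : (0 < l true)%N -> l true \in s.
Proof. by move=> h0; apply: (lo_mem H (b := true)). Qed.
Let lF : (0 < l false)%N -> l false \notin s.
Proof. by move=> h0; apply/negbT; apply: (lo_mem H (b := false)). Qed.
Let lFg j : (l false < j < k)%N -> j \in s.
Proof. by move=> h0; apply: (lo_gap H (b := false)). Qed.
Let hT : (h true < n)%N -> (h true).+1 \notin s.
Proof. by move=> h0; apply/negbT; apply: (hi_mem H (b := true)). Qed.
Let hF : (h false < n)%N -> (h false).+1 \in s.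
Proof. by move=> h0; apply: (hi_mem H (b := false)). Qed.
Let hTg j : (k < j <= h true)%N -> j \in s.
Proof. by move=> h0; apply: (hi_gap H (b := true)). Qed.
Let hFg j : (k < j <= h false)%N -> j \notin s.
Proof. by move=> h0; apply/negbT; apply: (hi_gap H (b := false)). Qed.

(** When in range, [l false] and [(h true).+1] are undrawn, so no block formed by [k] and drawn
    labels gets past them. *)
Let block_bounds c d : (c <= k <= d)%N ->
  (forall m, c <= m <= d -> 0 < m <= n -> m != k -> m \in s)%N ->
  ((0 < l false -> l false < c) /\ (h true < n -> d <= h true))%N.
Proof.
have lf := l_lt false; have ht := h_ge true.
move=> ckd mem; split=> [l0|h0]; rewrite ?ltnNge 1?leqNgt; apply/negP => le.
  by move/negP: (lF l0); apply; apply: mem; nlia.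
by move/negP: (hT h0); apply; apply: mem; nlia.
Qed.

(** Drawing [k] creates the block from [(l false).+1] to [h true], whose outer corner is the top
    right corner of the box. What it adds to the left of the box or below it was already covered by
    blocks ending at [l true] or starting at [(h false).+1]. *)
Lemma stair_rcons : stair (rcons s k) = stair s `|` region (nbox l h).
Proof.
have lt := l_lt true; have lf := l_lt false; have ht := h_ge true; have hf := h_ge false.
have hln := h_le true; have hfn := h_le false.
apply/seteqP; split=> q.
  move=> [Sq [c [d [cd mem h1 h2]]]].
  have [/andP[ck kd]|nk] := boolP (c <= k <= d)%N; last first.
    left; split=> //; exists c, d; split=> // m mm m0.
    by have := mem m mm m0; rewrite mem_rcons inE => /orP[/eqP e|//]; nlia.
  have mem' m : (c <= m <= d)%N -> (0 < m <= n)%N -> m != k -> m \in s.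
    by move=> mm m0 mk; have := mem m mm m0; rewrite mem_rcons inE (negbTE mk).
  have [lc dh] := block_bounds (c := c) (d := d) ltac:(by rewrite ck kd) mem'.
  have /SE Sq' := Sq; have := Sq' true; have := Sq' false => V0 U0.
  have Vl : (l false)%:R <= co false q.
    have [->|l0] := posnP (l false); first by case/andP: V0.
    have : (l false).+1%:R <= c%:R :> R by rewrite ler_nat lc.
    by rewrite -natr1; lra.
  have Uh : co true q <= (h true)%:R.
    have [->|l0] := eqVneq (h true) n; first by case/andP: U0.
    have : d%:R <= (h true)%:R :> R by rewrite ler_nat dh // ltn_neqAle l0 hln.
    lra.
  have [Ul|Ul] := ltP (co true q) (l true)%:R.
    have l0 : (0 < l true)%N by rewrite -(ltr_nat R); lra.
    left; split=> //; have [cl|cl] := leqP c (l true).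
      exists c, (l true); split=> //; [nlia| |lra].
      by move=> m mm m0; apply: mem'; nlia.
    exists (l true), (l true); split=> //; [nlia| | |lra].
      by move=> m mm m0; rewrite (_ : m = l true); [exact: lT|nlia].
    have : (l true)%:R <= c%:R :> R by rewrite ler_nat; nlia.
    lra.
  have [Vh|Vh] := ltP (h false)%:R (co false q).
    left; split=> //; have [cl|cl] := leqP (h false).+1 d.
      exists (h false).+1, d; split=> //; [nlia| |rewrite -natr1; lra].
      by move=> m mm m0; apply: mem'; nlia.
    exists (h false).+1, (h false).+1; split=> //; [nlia| |rewrite -natr1; lra|].
      by move=> m mm m0; rewrite (_ : m = (h false).+1); [apply: hF|]; nlia.
    have : d%:R <= (h false).+1%:R :> R by rewrite ler_nat; nlia.
    lra.
  right; apply/(regionE n) => b; rewrite (co_tl _ _ l h) (co_br _ _ l h).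
  by case: b; lra.
case=> [[Sq [c [d [cd mem h1 h2]]]]|/(regionE n) rq].
  split=> //; exists c, d; split=> // m mm m0.
  by rewrite mem_rcons inE mem ?orbT.
have rqb b : (l b)%:R <= co b q <= (h b)%:R.
  by have := rq b; rewrite (co_tl _ _ l h) (co_br _ _ l h).
split.
  apply/SE => b; have := rqb b.
  have : (h b)%:R <= n%:R :> R by rewrite ler_nat.
  have : 0 <= (l b)%:R :> R by [].
  lra.
exists (l false).+1, (h true); split; [nlia| |rewrite -natr1; have := rqb false; lra|have := rqb true; lra].
move=> m mm m0; rewrite mem_rcons inE.
by have [//|mk] := eqVneq m k; have [lt'|gt'] := ltnP m k; [apply: lFg|apply: hTg]; nlia.
Qed.

(** This is the test made by [rho]: a block reaching the point must end at [k - 1], because [k] is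
    not drawn. *)
Lemma stair_dpoint_pred : stair s (dpoint R n k.-1) <-> l true = k.-1.
Proof.
have lt := l_lt true.
split=> [[_ [c [d [cd mem]]]]|e].
  rewrite !co_dpoint natr1 !ler_nat => h1 h2.
  have dk : d = k.-1.
    have [kd|] := leqP k d; last nlia.
    by move/negP: ks; case; apply: mem; nlia.
  have := lo_le H (b := true) (j := k.-1) ltac:(nlia).
  by move=> /(_ (fun j0 => mem k.-1 ltac:(nlia) ltac:(nlia))); nlia.
split; first by apply/SE => b; rewrite co_dpoint ler0n ler_nat; nlia.
exists k.-1, k.-1; rewrite !co_dpoint natr1 !ler_nat; split=> //; first nlia.
by move=> m mm m0; rewrite (_ : m = l true); [apply: lT|]; nlia.
Qed.

Lemma stair_dpoint : stair s (dpoint R n k) <-> h false = k.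
Proof.
have ht := h_ge false; have hn := h_le false.
split=> [[_ [c [d [cd mem]]]]|e].
  rewrite !co_dpoint natr1 !ler_nat => h1 h2.
  have dk : c = k.+1.
    have [kd|] := leqP c k; last nlia.
    by move/negP: ks; case; apply: mem; nlia.
  have [//|kn] := eqVneq (h false) k.
  have := hFg (j := k.+1) ltac:(nlia); rewrite mem //; nlia.
split; first by apply/SE => b; rewrite co_dpoint ler0n ler_nat; nlia.
exists k.+1, k.+1; rewrite !co_dpoint natr1 !ler_nat; split=> //; first nlia.
by move=> m mm m0; rewrite (_ : m = (h false).+1); [apply: hF|]; nlia.
Qed.

Lemma xget_highest (p q : point R) (A : set (point R)) : highest A q ->
  (forall q', A q' -> q'.1 = q.1) -> xget p (highest A) = q.
Proof.
move=> hq e; apply: xget_unique => // q' [Aq' mx].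
case: hq => Aq mx'; have := mx _ Aq; have := mx' _ Aq'; have := e _ Aq'.
by case: q q' {Aq Aq' mx mx' e} => [q1 q2] [q1' q2'] /= -> ? ?; congr (_, _); lra.
Qed.

Lemma xget_rightmost (p q : point R) (A : set (point R)) : rightmost A q ->
  (forall q', A q' -> q'.2 = q.2) -> xget p (rightmost A) = q.
Proof.
move=> hq e; apply: xget_unique => // q' [Aq' mx].
case: hq => Aq mx'; have := mx _ Aq; have := mx' _ Aq'; have := e _ Aq'.
by case: q q' {Aq Aq' mx mx' e} => [q1 q2] [q1' q2'] /= -> ? ?; congr (_, _); lra.
Qed.

Let lo_cases : l true = k.-1 \/ (l true < k.-1)%N /\ l false = k.-1.
Proof.
have lt := l_lt true; have lf := l_lt false.
have [->|ne] := eqVneq (l true) k.-1; [by left|right; split; first nlia].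
have := lo_le H (b := false) (j := k.-1) ltac:(nlia).
rewrite (lo_gap H (b := true) (j := k.-1)); last nlia.
by move=> /(_ (fun=> erefl)); nlia.
Qed.

Let hi_cases : h false = k \/ (k < h false)%N /\ h true = k.
Proof.
have ht := h_ge true; have hf := h_ge false; have hn := h_le false.
have [->|ne] := eqVneq (h false) k; [by left|right; split; first nlia].
have := hi_lt_of H (b := true) (j := k.+1) ltac:(nlia).
rewrite (hi_gap H (b := false) (j := k.+1)); last nlia.
by move=> /(_ erefl); nlia.
Qed.

Let kP : k.-1%:R + 1 = k%:R :> R.
Proof. by rewrite natr1 prednK //; nlia. Qed.

(** If [k - 1] is drawn or 0, the staircase above the point rises to the start of the block of
    [k - 1], at depth [l false]. Otherwise [l false] is [k - 1], and the row left of the point is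
    covered up to the last drawn label, [l true]. *)
Lemma draw_tl : (if `[< stair s (dpoint R n k.-1) >]
    then highest_above (stair s) (dpoint R n k.-1)
    else rightmost_left (stair s) (dpoint R n k.-1)) = pt true (l true)%:R (l false)%:R.
Proof.
have lt := l_lt true; have lf := l_lt false.
case: asboolP => [/stair_dpoint_pred e|/stair_dpoint_pred ne].
  have lfk : k = 1%N \/ (l false < k.-1)%N.
    have [k1|k1] := leqP k 1; first by left; nlia.
    right; rewrite ltn_neqAle; apply/andP; split; last nlia.
    by apply/eqP => e'; have := lT; have := lF; rewrite e e' => /(_ ltac:(nlia)) /negP + /(_ ltac:(nlia)).
  apply: xget_highest => [|q' [_ -> _]]; last by rewrite e.
  split.
    split; [|by rewrite /= e|].
    - split.
        by apply/SE => -[]; rewrite ?co_pt ?(@co_ptN _ n true) ler0n ler_nat; nlia.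
      case: lfk => [k1|lfk].
        exists 0%N, 0%N; rewrite co_pt (@co_ptN _ n true); split=> //; first by move=> m; nlia.
          by rewrite addr_ge0.
        by rewrite e k1.
      exists (l false).+1, k.-1; rewrite co_pt (@co_ptN _ n true) natr1 e; split=> //; first nlia.
      by move=> m mm m0; apply: lFg; nlia.
    - by rewrite /= lerD2l lerN2 ler_nat; nlia.
  move=> q' [[/SE Sq [c [d [cd mem h1 h2]]]] e1 e2].
  have := Sq false; rewrite /= in e1 e2 h1 h2 * => V0.
  rewrite e1 in h2.
  have kd : (k.-1 <= d)%N by rewrite -(ler_nat R).
  have ck : (c <= k)%N by rewrite -(ler_nat R); move: kP; lra.
  have dk : d = k.-1.
    have [kd'|] := leqP k d; last nlia.
    by move/negP: ks; case; apply: mem; nlia.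
  suff : (l false)%:R <= n%:R - q'.2 by lra.
  have [->|l0] := posnP (l false); first lra.
  have lc : (l false < c)%N.
    rewrite ltnNge; apply/negP => le.
    by have := lF l0; rewrite mem //; nlia.
  have : (l false).+1%:R <= c%:R :> R by rewrite ler_nat.
  by rewrite -natr1; lra.
have {ne} [//|[ltk e]] := lo_cases.
apply: xget_rightmost => [|q' [_ -> _]]; last by rewrite /= e.
split.
  split; [|by rewrite /= e|by rewrite /= ltr_nat].
  split.
    by apply/SE => -[]; rewrite ?co_pt ?(@co_ptN _ n true) ler0n ler_nat; nlia.
  exists (l true), (l true); rewrite co_pt (@co_ptN _ n true) natr1 ler_nat; split=> //; [nlia| |nlia].
  by move=> m mm m0; rewrite (_ : m = l true); [apply: lT|]; nlia.
move=> q' [[/SE Sq [c [d [cd mem h1 h2]]]] e1 e2].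
rewrite /= in e1 e2 h1 h2 *.
have ck : (c <= k)%N by rewrite -(ler_nat R); move: kP; lra.
have dk : (d < k)%N.
  by rewrite ltnNge; apply/negP => kd'; move/negP: ks; case; apply: mem; nlia.
have dl : (d <= l true)%N.
  by apply: (lo_le H) => // d0; apply: mem; nlia.
have : d%:R <= (l true)%:R :> R by rewrite ler_nat.
lra.
Qed.

(** If [k + 1] is drawn or [n + 1], its block extends to the right up to [h true]. Otherwise
    [h true] is [k], and the column below the point is covered from depth [h false] on. *)
Lemma draw_br : (if `[< stair s (dpoint R n k) >]
    then rightmost_right (stair s) (dpoint R n k)
    else highest_below (stair s) (dpoint R n k)) = pt true (h true)%:R (h false)%:R.
Proof.
have ht := h_ge true; have hf := h_ge false; have hn := h_le false; have hn' := h_le true.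
case: asboolP => [/stair_dpoint e|/stair_dpoint ne].
  have htk : k = n \/ (k < h true)%N.
    have [k1|k1] := leqP n k; first by left; nlia.
    right; rewrite ltn_neqAle; apply/andP; split; last nlia.
    by apply/eqP => e'; have := hT; have := hF; rewrite e -e' => /(_ ltac:(nlia)) + /(_ ltac:(nlia)) /negP.
  apply: xget_rightmost => [|q' [_ -> _]]; last by rewrite /= e.
  split.
    split; [|by rewrite /= e|by rewrite /= ler_nat].
    split.
      by apply/SE => -[]; rewrite ?co_pt ?(@co_ptN _ n true) ler0n ler_nat; nlia.
    case: htk => [k1|htk].
      exists n.+1, n.+1; rewrite co_pt (@co_ptN _ n true) natr1 !ler_nat; split=> //; [nlia| |nlia|nlia].
      by move=> m; nlia.
    exists k.+1, (h true); rewrite co_pt (@co_ptN _ n true) natr1 e; split=> //; first nlia.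
    by move=> m mm m0; apply: hTg; nlia.
  move=> q' [[/SE Sq [c [d [cd mem h1 h2]]]] e1 e2].
  have := Sq true; rewrite /= in e1 e2 h1 h2 * => U0.
  have kd : (k <= d)%N by rewrite -(ler_nat R); lra.
  have ck : (c <= k.+1)%N by rewrite -(ler_nat R) -natr1; lra.
  have dk : c = k.+1.
    have [kd'|] := leqP c k; last nlia.
    by move/negP: ks; case; apply: mem; nlia.
  have [->|l0] := eqVneq (h true) n; first lra.
  have hd : (d <= h true)%N.
    rewrite leqNgt; apply/negP => le.
    by have := hT ltac:(nlia); rewrite mem //; nlia.
  have : d%:R <= (h true)%:R :> R by rewrite ler_nat.
  lra.
have {ne} [//|[ltk e]] := hi_cases.
apply: xget_highest => [|q' [_ -> _]]; last by rewrite /= e.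
split.
  split; [|by rewrite /= e|by rewrite /= ltrD2l ltrN2 ltr_nat].
  split.
    by apply/SE => -[]; rewrite ?co_pt ?(@co_ptN _ n true) ler0n ler_nat; nlia.
  exists (h false).+1, (h false).+1; rewrite co_pt (@co_ptN _ n true) natr1 !ler_nat; split=> //; [nlia| |nlia].
  by move=> m mm m0; rewrite (_ : m = (h false).+1); [apply: hF|]; nlia.
move=> q' [[/SE Sq [c [d [cd mem h1 h2]]]] e1 e2].
rewrite /= in e1 e2 h1 h2 *; rewrite e1 in h2.
have kd : (k <= d)%N by rewrite -(ler_nat R).
have ck : (k < c)%N.
  by rewrite ltnNge; apply/negP => kd'; move/negP: ks; case; apply: mem; nlia.
have hc : ((h false).+1 <= c)%N.
  rewrite ltnNge; apply/negP => le.
  by have := hFg (j := c) ltac:(nlia); rewrite mem //; nlia.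
have : (h false).+1%:R <= c%:R :> R by rewrite ler_nat.
rewrite -natr1; lra.
Qed.

Lemma draw_stair : draw n (stair s) k = nbox l h.
Proof. by rewrite /draw draw_tl draw_br. Qed.
End Step.

(** [rho] for an arbitrary word, so that it can be followed along prefixes. *)
Definition draw_word (s : seq nat) : set (rectangle R) :=
  foldl (fun D k => D `|` [set draw n (drawn n D) k]) set0 s.

Lemma drawn_draw_word s : uniq s -> {in s, forall k, 1 <= k <= n}%N -> drawn n (draw_word s) = stair s.
Proof.
elim/last_ind: s => [_ _|s k IH].
  by rewrite /drawn bigcup_set0 setU0 stair_nil.
rewrite rcons_uniq => /andP[ks us] sn.
have kn : (1 <= k <= n)%N by apply: sn; rewrite mem_rcons mem_head.
have {}IH : drawn n (draw_word s) = stair s.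
  by apply: IH => // j js; apply: sn; rewrite mem_rcons inE js orbT.
have B := is_box_ex (mem s) kn.
rewrite (stair_rcons kn ks B) /draw_word foldl_rcons -/(draw_word s) IH (draw_stair kn ks B).
by rewrite -IH /drawn bigcup_setU bigcup_set1 setUA.
Qed.

Lemma draw_wordE s l h : uniq s -> {in s, forall k, 1 <= k <= n}%N ->
  (forall s1 k s2, s = s1 ++ k :: s2 -> is_box n (mem s1) k (l k) (h k)) ->
  draw_word s = [set nbox (l k) (h k) | k in [set` s]].
Proof.
elim/last_ind: s => [_ _ _|s k IH].
  by rewrite set_nil image_set0.
move=> us sn B.
have kn : (1 <= k <= n)%N by apply: sn; rewrite mem_rcons mem_head.
have sn' : {in s, forall k, 1 <= k <= n}%N.
  by move=> j js; apply: sn; rewrite mem_rcons inE js orbT.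
have [ks us'] : k \notin s /\ uniq s by move: us; rewrite rcons_uniq => /andP.
have Bk : is_box n (mem s) k (l k) (h k) by apply: (B s k [::]); rewrite cats1.
rewrite /draw_word foldl_rcons -/(draw_word s) drawn_draw_word // (draw_stair kn ks Bk) IH //; last first.
  by move=> s1 j s2 e; apply: (B s1 j (rcons s2 k)); rewrite e rcons_cat.
apply/seteqP; split=> r.
  by move=> [[j js <-]|->]; [exists j|exists k]; rewrite //= mem_rcons inE ?eqxx // js orbT.
move=> [j] /=; rewrite mem_rcons inE => /orP[/eqP ->|js] <-; first by right.
by left; exists j.
Qed.

Lemma rhoE (x : 'S_n) : rho R x = draw_word (one_line x).
Proof. by []. Qed.
End Drawing.

End Geometry.

(** * One-line notation *)

Section OneLine.
Variable n : nat.
Implicit Types x y z : 'S_n.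

Definition pos x v := index v (one_line x).

Lemma size_one_line x : size (one_line x) = n.
Proof. by rewrite size_map -cardE card_ord. Qed.

Lemma nth_one_line x (i : 'I_n) : nth 0 (one_line x) i = (x i).+1.
Proof. by rewrite (nth_map i) ?nth_ord_enum // -cardE card_ord. Qed.

Lemma one_line_uniq x : uniq (one_line x).
Proof. by rewrite map_inj_uniq ?enum_uniq // => i j [/val_inj /perm_inj]. Qed.

Lemma mem_one_line x v : (v \in one_line x) = (1 <= v <= n).
Proof.
apply/mapP/idP => [[i _ ->]|vn]; first by have := ltn_ord (x i); lia.
have vn' : v.-1 < n by lia.
exists ((x^-1)%g (Ordinal vn')); first by rewrite mem_enum.
by rewrite permKV /=; lia.
Qed.

Lemma one_line_perm x : perm_eq (one_line x) (iota 1 n).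
Proof.
apply: uniq_perm; [exact: one_line_uniq|exact: iota_uniq|].
by move=> v; rewrite mem_one_line mem_iota add1n ltnS.
Qed.

Lemma one_line_inj : injective (@one_line n).
Proof.
move=> x y e; apply/permP => i; apply/val_inj/eqP; rewrite /= -eqSS.
by rewrite -!nth_one_line e.
Qed.

Lemma pos_val x (i : 'I_n) : pos x (x i).+1 = i.
Proof. by rewrite /pos -nth_one_line index_uniq ?one_line_uniq ?size_one_line. Qed.

Lemma val_ex x v : 1 <= v <= n -> exists i : 'I_n, v = (x i).+1.
Proof. by rewrite -(mem_one_line x) => /mapP[i _ ->]; exists i. Qed.

Lemma pos_out x v : ~~ (1 <= v <= n) -> pos x v = n.
Proof. by rewrite -(mem_one_line x) /pos => /memNindex ->; rewrite size_one_line. Qed.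

Lemma pos_inj x i j : 1 <= i <= n -> 1 <= j <= n -> pos x i = pos x j -> i = j.
Proof. by move=> /(val_ex x)[a ->] /(val_ex x)[b ->]; rewrite !pos_val => /val_inj ->. Qed.

Lemma mem_before x s1 k s2 v : one_line x = s1 ++ k :: s2 ->
  (v \in s1) = (pos x v < pos x k).
Proof.
move=> e; have := one_line_uniq x; rewrite /pos e cat_uniq /= negb_or.
move=> /and3P[_ /andP[ks1 _] _]; rewrite !index_cat (negbTE ks1) /= eqxx addn0.
case: ifP => vs; first by rewrite index_mem.
by lia.
Qed.

Lemma one_line_ex w : perm_eq w (iota 1 n) -> exists x, one_line x = w.
Proof.
move=> pw; have sw : size w = n by rewrite (perm_size pw) size_iota.
have uw : uniq w by rewrite (perm_uniq pw) iota_uniq.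
have wn (i : 'I_n) : 1 <= nth 0 w i <= n.
  have : nth 0 w i \in w by rewrite mem_nth // sw.
  by rewrite (perm_mem pw) mem_iota; lia.
have lt (i : 'I_n) : (nth 0 w i).-1 < n by have := wn i; lia.
have inj : injective (fun i => Ordinal (lt i)).
  move=> i j [e]; apply/val_inj/eqP => /=.
  have e' : nth 0 w i = nth 0 w j by have := wn i; have := wn j; lia.
  by rewrite -(nth_uniq 0 _ _ uw) ?sw ?e'.
exists (perm inj); apply: (@eq_from_nth _ 0); rewrite size_one_line ?sw // => i ii.
by rewrite (nth_one_line _ (Ordinal ii)) permE /=; have := wn (Ordinal ii); rewrite /=; lia.
Qed.

Lemma boxes_ex x : exists l h, is_boxes n (pos x) l h.
Proof.
exists (fun k => box_lo (fun j => pos x j < pos x k) k).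
exists (fun k => box_hi n (fun j => pos x j < pos x k) k).
by move=> k kk; apply: is_box_ex.
Qed.

(** The two patterns differ only in the order of the values [v] and [w]. *)
Lemma twisted_baxter_pos x : twisted_baxter x ->
  forall a d v w, 1 <= a -> d <= n -> pos x a = (pos x d).+1 ->
  a < v < d -> a < w < d -> pos x v < pos x d -> pos x a < pos x w -> False.
Proof.
move=> [n1 n2] a d v w a1 dn ad vv ww.
have [k ek] := @val_ex x a ltac:(lia); have [j ej] := @val_ex x d ltac:(lia).
have [i ei] := @val_ex x v ltac:(lia); have [l el] := @val_ex x w ltac:(lia).
move: ad vv ww; rewrite ei el ek ej !pos_val => kj vv ww ij kl.
have [lt|gt|e] := ltngtP (x i) (x l); last first.
  by move: ij; rewrite (perm_inj (val_inj e)); lia.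
  by apply: n1; exists i, j, k, l; split=> //; split; lia.
by apply: n2; exists i, j, k, l; split=> //; split; lia.
Qed.

(** Each permutation forces its inversions on the other, so they order any two labels alike. *)
Lemma twisted_baxter_unique x y l h : twisted_baxter x -> twisted_baxter y ->
  is_boxes n (pos x) l h -> is_boxes n (pos y) l h -> x = y.
Proof.
have forced z z' : twisted_baxter z -> is_boxes n (pos z) l h -> is_boxes n (pos z') l h ->
    forall a d, 1 <= a < d -> d <= n -> pos z d < pos z a -> pos z' d < pos z' a.
  move=> tb Hz Hz' a d; apply: (@inversion_forced n (pos z) (pos z') (nth 0 (one_line z))).
  - by move=> i ii; rewrite (nth_one_line z (Ordinal ii)) /=; apply: ltn_ord.
  - by move=> j /(val_ex z)[i ->]; rewrite pos_val.
  - by move=> j /(val_ex z)[i ->]; rewrite pos_val nth_one_line.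
  - by move=> i ii; rewrite (nth_one_line z (Ordinal ii)) pos_val.
  - exact: pos_inj.
  - exact: twisted_baxter_pos.
  - exact: Hz.
  - exact: Hz'.
move=> tx ty Hx Hy; apply: one_line_inj.
have le u v : 1 <= u <= n -> 1 <= v <= n -> pos y u < pos y v -> pos x u < pos x v.
  move=> un vn lt; have [uv|vu|e] := ltngtP u v; last by rewrite e ltnn in lt.
    have := forced x y tx Hx Hy u v ltac:(lia) ltac:(lia).
    have := pos_neq (@pos_inj x) un vn ltac:(lia); lia.
  by apply: (forced y x ty Hy Hx); lia.
(* Both words have the same entries and are increasing for the order of positions in [x]. *)
apply: (@irr_sorted_eq _ (fun u v => pos x u < pos x v)).
- by move=> u v w; apply: ltn_trans.
- by move=> u; rewrite /= ltnn.
- apply/(sortedP 0) => i; rewrite size_one_line => ii.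
  by rewrite /pos !index_uniq ?one_line_uniq ?size_one_line //; lia.
- apply/(sortedP 0) => i; rewrite size_one_line => ii.
  have yn j : j < n -> 1 <= nth 0 (one_line y) j <= n.
    by move=> jn; rewrite -(mem_one_line y) mem_nth ?size_one_line.
  apply: le; [apply: yn; lia|exact: yn|].
  by rewrite /pos !index_uniq ?one_line_uniq ?size_one_line //; lia.
- by move=> v; rewrite !mem_one_line.
Qed.

(* Sorting an adjacent descent d a that is part of a forbidden pattern keeps the
   boxes: d and a only matter to each other's boxes, and there they are screened
   by the entries v before and w after with values between them. *)
Lemma swap_boxes z (i j k m : 'I_n) l h : i < j -> k = j.+1 :> nat -> k < m ->
  z k < z i < z j -> z k < z m < z j ->
  is_boxes n (pos z) l h -> is_boxes n (pos (tperm j k * z)%g) l h.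
Proof.
move=> ij kj km hi hm H; set z' := (_ * z)%g.
have pos' (t : 'I_n) : pos z' (z t).+1 = tperm j k t.
  have -> : z t = z' (tperm j k t) by rewrite permM tpermK.
  exact: pos_val.
have pos_eq u : u != (z j).+1 -> u != (z k).+1 -> pos z' u = pos z u.
  have [/(val_ex z)[t ->]|uo _ _] := boolP (1 <= u <= n); last by rewrite !pos_out.
  rewrite pos' pos_val => uj uk; rewrite tpermD //; [apply: contraNneq uj|apply: contraNneq uk] => -> //.
have pj : pos z' (z j).+1 = k by rewrite pos' tpermL.
have pk : pos z' (z k).+1 = j by rewrite pos' tpermR.
have pi u : pos z u = j -> u = (z j).+1.
  have [/(val_ex z)[t ->]|uo] := boolP (1 <= u <= n); last by rewrite pos_out //; have := ltn_ord j; lia.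
  by rewrite pos_val => /val_inj ->.
have pi' u : pos z u = k -> u = (z k).+1.
  have [/(val_ex z)[t ->]|uo] := boolP (1 <= u <= n); last by rewrite pos_out //; have := ltn_ord k; lia.
  by rewrite pos_val => /val_inj ->.
have zn t : 1 <= (z t).+1 <= n by have := ltn_ord (z t); lia.
move=> u un; have [ej|nj] := eqVneq u (z j).+1.
  rewrite ej pj; apply: (is_box_flip (z := (z k).+1) (v := (z i).+1) (w := (z m).+1))
    (H _ (zn j)); last 2 first.
  - by rewrite !pos_val.
  - by rewrite !pos_val -leqNgt; lia.
  - move=> t tk; rewrite pos_val; have [->|tj] := eqVneq t (z j).+1; first by rewrite pj pos_val !ltnn.
    by rewrite pos_eq // kj; have := pi t; move: tj => /eqP; lia.
  - by apply/orP; left; lia.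
have [ek|nk] := eqVneq u (z k).+1.
  rewrite ek pk; apply: (is_box_flip (z := (z j).+1) (v := (z i).+1) (w := (z m).+1))
    (H _ (zn k)); last 2 first.
  - by rewrite !pos_val; lia.
  - by rewrite !pos_val -leqNgt; lia.
  - move=> t tj; rewrite pos_val; have [->|tk] := eqVneq t (z k).+1; first by rewrite pk pos_val !ltnn.
    by rewrite pos_eq // kj; have := pi t; move: tj => /eqP; lia.
  - by apply/orP; right; lia.
(* The positions [j] and [k] are adjacent, so the exchange moves neither label across a third label
   [u]. *)
apply: is_box_ext (H u un) => t tn _; rewrite (pos_eq u) //.
have pu := pi u; have pu' := pi' u; move/eqP: nj => nj; move/eqP: nk => nk.
have [->|tj] := eqVneq t (z j).+1; first by rewrite pj pos_val; lia.
have [->|tk] := eqVneq t (z k).+1; first by rewrite pk pos_val; lia.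
by rewrite pos_eq.
Qed.

(** The rearrangement inequality for one exchange; the weight serves to choose an extremal
    permutation of a fibre. *)
Lemma swap_weight z (j k : 'I_n) : j < k -> z k < z j ->
  \sum_(t < n) t * z t < \sum_(t < n) t * (tperm j k * z)%g t.
Proof.
move=> jk lt; have nkj : k != j by rewrite -val_eqE /=; lia.
rewrite (bigD1 j) // (bigD1 k) //= [X in _ < X](bigD1 j) // [X in _ < _ + X](bigD1 k) //=.
rewrite !permM tpermL tpermR.
rewrite (eq_bigr (fun t : 'I_n => t * (tperm j k * z)%g t)) => [|t /andP[tj tk]]; last first.
  by rewrite permM tpermD // eq_sym.
have aux (a b c d s : nat) : a < b -> d < c -> a * c + (b * d + s) < a * d + (b * c + s).
  by nia.
exact: aux.
Qed.

(** A permutation of largest weight with these boxes avoids both patterns: sorting the descent of a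
    pattern would keep the boxes and raise the weight. *)
Lemma twisted_baxter_ex x l h : is_boxes n (pos x) l h ->
  exists2 z, twisted_baxter z & is_boxes n (pos z) l h.
Proof.
move=> Hx; have Px : `[< is_boxes n (pos x) l h >] by apply/asboolP.
case: (@arg_maxnP _ x (fun z => `[< is_boxes n (pos z) l h >])
  (fun z : 'S_n => \sum_(t < n) t * z t) Px) => z /asboolP Hz zmax.
exists z => //.
have bad (i j k m : 'I_n) : i < j -> k = j.+1 :> nat -> k < m ->
    z k < z i < z j -> z k < z m < z j -> False.
  move=> ij kj km hi hm.
  have /asboolP/zmax := swap_boxes ij kj km hi hm Hz.
  by rewrite /= leqNgt swap_weight //; lia.
split=> [[i [j [k [m [ij kj km [h1 h2 h3]]]]]]|[i [j [k [m [ij kj km [h1 h2 h3]]]]]]].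
  by apply: (bad i j k m) => //; lia.
by apply: (bad i j k m) => //; lia.
Qed.

End OneLine.

(** * The fibres of [rho] and the bijection *)

Section Rho.
Variables (R : realType) (n : nat).
Hypothesis n_gt0 : 0 < n.

Lemma set_iota_one_line (x : 'S_n) : [set` one_line x] = [set` iota 1 n].
Proof. by apply/seteqP; split=> k /=; rewrite (perm_mem (one_line_perm x)). Qed.

Lemma rho_boxes (x : 'S_n) l h : is_boxes n (pos x) l h -> rho R x = boxes R n l h.
Proof.
move=> H; rewrite rhoE (draw_wordE R n_gt0 (one_line_uniq x) (l := l) (h := h)).
- by rewrite set_iota_one_line.
- by move=> k; rewrite mem_one_line.
move=> s1 k s2 e.
have kn : 1 <= k <= n by rewrite -(mem_one_line x) e mem_cat mem_head orbT.
by apply: is_box_ext (H k kn) => j _ _; rewrite /= (mem_before _ e).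
Qed.

(** A box determines its label, so equal sets of boxes agree label by label. *)
Lemma boxes_inj l h l' h' p p' :
  (forall i j, 1 <= i <= n -> 1 <= j <= n -> p i = p j -> i = j) ->
  (forall i j, 1 <= i <= n -> 1 <= j <= n -> p' i = p' j -> i = j) ->
  is_boxes n p l h -> is_boxes n p' l' h' ->
  boxes R n l h = boxes R n l' h' -> is_boxes n p' l h.
Proof.
move=> pinj pinj' H H' e k kk.
have label q f g : (forall i j, 1 <= i <= n -> 1 <= j <= n -> q i = q j -> i = j) ->
    is_boxes n q f g -> forall m, 1 <= m <= n -> tile_label n m (f m) (g m).
  move=> qinj Hq m mm; split; [|exact: lo_diag Hq _ mm|exact: hi_diag Hq _ mm].
  by move=> b; have := lo_lt (Hq m mm) b; have := hi_ge (Hq m mm) b; have := hi_le (Hq m mm) b; lia.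
have : boxes R n l h (nbox R n (l k) (h k)).
  by exists k => //=; rewrite mem_iota; lia.
rewrite e => -[k' /=]; rewrite mem_iota => kk' /esym e'.
have kk1 : 1 <= k' <= n by lia.
have [e1 e2] := nbox_inj e'; have L := label _ _ _ pinj H k kk; have L' := label _ _ _ pinj' H' k' kk1.
rewrite (funext e1) (funext e2) in L *.
by rewrite (tile_label_inj L L'); apply: H'.
Qed.
End Rho.

Theorem theorem6p1 (R : realType) (n : nat) (hn : (1 <= n)%N) :
  (forall x : 'S_n, dRec R n (rho R x)) /\
  set_bij [set x : 'S_n | twisted_baxter x] (dRec R n) (fun x : 'S_n => rho R x).
Proof.
have rho_dRec (x : 'S_n) : dRec R n (rho R x).
  have [l [h H]] := boxes_ex x.
  by rewrite (rho_boxes R hn H); apply: (boxes_dRec R hn (@pos_inj n x) H).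
split=> //; split.
- by move=> x _; apply: rho_dRec.
- move=> x y /set_mem tx /set_mem ty e.
  have [l [h Hx]] := boxes_ex x; have [l' [h' Hy]] := boxes_ex y.
  have e' : boxes R n l h = boxes R n l' h'.
    by rewrite -(rho_boxes R hn Hx) -(rho_boxes R hn Hy).
  apply: (twisted_baxter_unique tx ty Hx).
  exact: boxes_inj (@pos_inj n x) (@pos_inj n y) Hx Hy e'.
(* Peeling off the tiles gives some preimage, which is then replaced by a twisted Baxter permutation
   with the same boxes. *)
- move=> D HD; have [w [l [h [pw B ->]]]] := dRec_word hn HD.
  have [x ex] := one_line_ex pw.
  have Hx : is_boxes n (pos x) l h.
    move=> k kk; have kw : k \in one_line x by rewrite mem_one_line.
    have [s1 [s2 e]] : exists s1 s2, one_line x = s1 ++ k :: s2.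
      by case/splitPr: kw => s1 s2; exists s1, s2.
    apply: is_box_ext (B s1 k s2 ltac:(by rewrite -ex)) => j _ _ /=.
    by rewrite (mem_before _ e).
  have [z tz Hz] := twisted_baxter_ex Hx.
  by exists z => //; rewrite (rho_boxes R hn Hz).
Qed.
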